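(* Let $K$ be an infinite field. When $\mathrm{char}(K)\neq 2$, assume that $L/K$ is an abelian extension of degree $12$, $14$, $15$, $20$, $21$, or $30$. When $\mathrm{char}(K)=2$, assume that $L/K$ is an abelian extension of degree $12$, $14$, $15$, or $20$. Then there exist infinitely many elliptic curves $E/K$ with pairwise distinct $j$-invariants and with a new point over $L$.
   Context: For a scheme $X$ of finite type over $K$ and a finite extension $L/K$, a point of $X(L)$ is new (one also says that $X$ has a new point over $L$) if it does not belong to $\bigcup_F X(F)$, where $F$ runs over all proper subfields $K\subseteq F\subset L$. An abelian extension is a Galois extension with abelian Galois group. *)

(* Defs.v *)
From HB Require Import structures.
From mathcomp Require Import all_boot all_order all_algebra all_fingroup all_field.
From mathcomp Require Import classical_sets functions cardinality.

Set Implicit Arguments.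
Unset Strict Implicit.
Unset Printing Implicit Defensive.

Import GRing.Theory.
Local Open Scope ring_scope.
Local Open Scope classical_set_scope.

(* y^2 + a1 x y + a3 y = x^3 + a2 x^2 + a4 x + a6, in any characteristic *)
Record weierstrass (K : fieldType) := Weierstrass {
  wa1 : K; wa2 : K; wa3 : K; wa4 : K; wa6 : K }.

Section Invariants.
Variables (K : fieldType) (W : weierstrass K).
Local Notation a1 := (wa1 W).
Local Notation a2 := (wa2 W).
Local Notation a3 := (wa3 W).
Local Notation a4 := (wa4 W).
Local Notation a6 := (wa6 W).

Definition wb2 : K := a1 ^+ 2 + 4 * a2.
Definition wb4 : K := 2 * a4 + a1 * a3.
Definition wb6 : K := a3 ^+ 2 + 4 * a6.
Definition wb8 : K :=
  a1 ^+ 2 * a6 + 4 * a2 * a6 - a1 * a3 * a4 + a2 * a3 ^+ 2 - a4 ^+ 2.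
Definition wc4 : K := wb2 ^+ 2 - 24 * wb4.
Definition wdisc : K :=
  - (wb2 ^+ 2 * wb8) - 8 * wb4 ^+ 3 - 27 * wb6 ^+ 2 + 9 * wb2 * wb4 * wb6.
End Invariants.

Record elliptic_curve (K : fieldType) := EllipticCurve {
  weierstrass_of :> weierstrass K;
  wdisc_neq0 : wdisc weierstrass_of != 0 }.

Definition j_invariant (K : fieldType) (E : elliptic_curve K) : K :=
  wc4 E ^+ 3 / wdisc E.

(* [Infinity] is the point [0 : 1 : 0], [Affine x y] is [x : y : 1]. *)
Inductive curve_point (L : Type) : Type :=
  Infinity | Affine (x y : L).
Arguments Infinity {L}.

Definition on_curve (K : fieldType) (L : fieldExtType K)
    (E : elliptic_curve K) (P : curve_point L) : Prop :=
  if P is Affine x y then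
    y ^+ 2 + wa1 E *: (x * y) + wa3 E *: y
      = x ^+ 3 + wa2 E *: x ^+ 2 + wa4 E *: x + (wa6 E)%:A
  else True.

Definition coords_in (K : fieldType) (L : fieldExtType K)
    (F : {subfield L}) (P : curve_point L) : bool :=
  if P is Affine x y then (x \in F) && (y \in F) else true.

(* E(F), viewed inside E(L), for an intermediate field K <= F <= L *)
Definition rational_points (K : fieldType) (L : fieldExtType K)
    (E : elliptic_curve K) (F : {subfield L}) : set (curve_point L) :=
  [set P | on_curve E P /\ coords_in F P].

(* Every {subfield L} contains K, the image of K in L being 1%AS. *)
Definition new_points (K : fieldType) (L : fieldExtType K)
    (E : elliptic_curve K) : set (curve_point L) :=
  rational_points E {:L}%AS `\`
  \bigcup_(F in [set F : {subfield L} | F != {:L}%AS]) rational_points E F.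

Definition has_new_point (K : fieldType) (L : fieldExtType K)
    (E : elliptic_curve K) : Prop :=
  @new_points K L E !=set0.

Definition abelian_extension (K : fieldType) (L : splittingFieldType K) : bool :=
  galois 1%AS {:L}%AS && abelian 'Gal({:L}%AS / 1%AS)%g.

(* Main.v *)
Require Import Defs.
From HB Require Import structures.
From mathcomp Require Import all_boot all_order all_algebra all_fingroup all_solvable all_field.
From mathcomp Require Import finmap boolp classical_sets functions cardinality.
From mathcomp Require Import ring.

(** Let F_1, F_2, ... be the subfields of L whose degrees are the prime powers exactly
    dividing [L : K]. Using norm forms N(P + X D) from the F_i, one writes down a plane cubic
    e z^2 + R(X) z + F(X) = 0 over K, with deg R <= 2 and deg F <= 3, carrying for each i a
    point that generates F_i. For instance, if the norm forms f and g from F_3 and F_4 agree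
    at 0 and 1, then f - g = X (X - 1) q and t z^2 + (t q - X (X - 1)) z - f = 0 has the
    points (X, 0) with f(X) = 0 and (X, X (X - 1) / t) with g(X) = 0. The cubic has a rational
    point at infinity, so it is an elliptic curve when it is smooth.

    As L/K is abelian, the third point on the chord through points generating F_1 and F_2
    generates F_1 F_2 when the degrees are coprime: if it lies in G then F_1 <= G F_2 and
    F_2 <= G F_1, so an automorphism h fixing G has both h^[F_1 : K] and h^[F_2 : K] acting
    trivially on F_1. Hence the chord construction yields a point generating L.

    The cubic depends on a parameter t, and for a special value of t it becomes nodal:
    there j has a pole, so j is not constant and takes infinitely many values on K. *)

(** Most points come from a substitution z = p(X) / q(X) over K under which the cubic becomes a
    multiple of the norm form of F_i. Above a root of that form, z is a function of X, so the point
    generates F_i as soon as X does. The obstacle is the small number of coefficients of a cubic: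
    two norm forms fit on it only if some of their values or coefficients are matched beforehand.
    For degrees (3, 4) and (3, 5) the norms of two generators are made equal, which works because
    scaling by K changes norms by powers with coprime exponents. In degrees 14, 20 and 30 the
    quadratic or quartic point is sought in a single fibre, above an X in K or in the quadratic
    field, where the cubic is a quadratic equation in z. In degrees 14 and 20 a norm form takes a
    square value at that X; this brings the equation to v^2 + k v + 1 = 0, which is solved by
    elements of relative norm 1. The nodal parameter need not be rational: a pole of j over an
    extension of K already makes j nonconstant. In degree 20 it does lie outside K. *)

Set Implicit Arguments.
Unset Strict Implicit.
Unset Printing Implicit Defensive.

Import GRing.Theory.
Local Open Scope ring_scope.

(** * Plane cubics and their Weierstrass equations *)

Record weier (R : Type) := Weier { w1 : R; w2 : R; w3 : R; w4 : R; w6 : R }.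

Section WeierRing.
Variable R : comNzRingType.
Implicit Types w : weier R.

Definition disc w : R :=
  let b2 := w1 w ^+ 2 + 4 * w2 w in
  let b4 := 2 * w4 w + w1 w * w3 w in
  let b6 := w3 w ^+ 2 + 4 * w6 w in
  let b8 := w1 w ^+ 2 * w6 w + 4 * w2 w * w6 w - w1 w * w3 w * w4 w
            + w2 w * w3 w ^+ 2 - w4 w ^+ 2 in
  - (b2 ^+ 2 * b8) - 8 * b4 ^+ 3 - 27 * b6 ^+ 2 + 9 * b2 * b4 * b6.

Definition inv4 w : R :=
  (w1 w ^+ 2 + 4 * w2 w) ^+ 2 - 24 * (2 * w4 w + w1 w * w3 w).

Definition weq w (x y : R) : R :=
  y ^+ 2 + w1 w * (x * y) + w3 w * y
  - (x ^+ 3 + w2 w * x ^+ 2 + w4 w * x + w6 w).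

(** The discriminant is invariant under translation. [w'] is the curve with (x, y) moved to the
    origin; its a3, a4 and a6 are the three expressions assumed to vanish, and every term of the
    discriminant contains one of them. *)
Lemma disc_singular w x y : weq w x y = 0 ->
  2 * y + w1 w * x + w3 w = 0 ->
  3 * x ^+ 2 + 2 * w2 w * x + w4 w - w1 w * y = 0 -> disc w = 0.
Proof.
case: w => a1 a2 a3 a4 a6; rewrite /weq /= => e0 ey ex.
pose w' := Weier a1 (a2 + 3 * x) (2 * y + a1 * x + a3)
  (3 * x ^+ 2 + 2 * a2 * x + a4 - a1 * y)
  (- (y ^+ 2 + a1 * (x * y) + a3 * y - (x ^+ 3 + a2 * x ^+ 2 + a4 * x + a6))).
have -> : disc (Weier a1 a2 a3 a4 a6) = disc w' by rewrite /disc /w' /=; ring.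
by rewrite /w' e0 ey ex /disc /=; ring.
Qed.

End WeierRing.

(* [ZCubic e r2 r1 r0 f3 f2 f1 f0] stands for the plane cubic
   e z^2 + (r2 X^2 + r1 X + r0) z + (f3 X^3 + f2 X^2 + f1 X + f0) = 0,
   with marked rational point [0 : 1 : 0]. *)
Record zcubic (R : Type) := ZCubic {
  ze : R; zr2 : R; zr1 : R; zr0 : R; zf3 : R; zf2 : R; zf1 : R; zf0 : R }.

Definition zmap (R S : Type) (f : R -> S) c :=
  ZCubic (f (ze c)) (f (zr2 c)) (f (zr1 c)) (f (zr0 c))
         (f (zf3 c)) (f (zf2 c)) (f (zf1 c)) (f (zf0 c)).

Definition wmap (R S : Type) (f : R -> S) w :=
  Weier (f (w1 w)) (f (w2 w)) (f (w3 w)) (f (w4 w)) (f (w6 w)).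

Section ZRing.
Variable R : comNzRingType.
Implicit Types c : zcubic R.

Definition zval c (X z : R) : R :=
  ze c * z ^+ 2 + (zr2 c * X ^+ 2 + zr1 c * X + zr0 c) * z
  + (zf3 c * X ^+ 3 + zf2 c * X ^+ 2 + zf1 c * X + zf0 c).

(** For e nonzero the line at infinity is tangent to the cubic at [0 : 1 : 0] and meets it again
    where r2 z + f3 X = 0. Hence [zx] has only a double pole, at the marked point, and [zy] corrects
    X [zx] to a function with only a triple pole there. *)
Definition zw c : weier R :=
  Weier (zr1 c)
    (- (ze c * zf2 c + zr0 c * zr2 c))
    (ze c * (zr0 c * zf3 c - zr2 c * zf1 c))
    (ze c * (zr0 c * zr2 c * zf2 c - zr0 c * zr1 c * zf3 c
             + zr2 c ^+ 2 * zf0 c + ze c * zf1 c * zf3 c))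
    (- (ze c ^+ 2 * (zr2 c ^+ 2 * zf2 c + ze c * zf3 c ^+ 2
             - zr1 c * zr2 c * zf3 c) * zf0 c)).

Definition zx c (X z : R) : R := - (ze c * (zr2 c * z + zf3 c * X)).
Definition zy c (X z : R) : R :=
  zr2 c * X * zx c X z - ze c * (zr2 c * zf2 c - zr1 c * zf3 c) * X
  + ze c ^+ 2 * zf3 c * z.

(** When r2 is nonzero, [za0] / r2^2 is the abscissa of the other point at infinity, where X has its
    second pole; this is why [zyE] cannot be solved for X there. *)
Definition za0 c : R :=
  ze c * (zr2 c ^+ 2 * zf2 c + ze c * zf3 c ^+ 2 - zr1 c * zr2 c * zf3 c).

Lemma zw_on c X z : zval c X z = 0 -> weq (zw c) (zx c X z) (zy c X z) = 0.
Proof.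
case: c => e r2 r1 r0 f3 f2 f1 f0; rewrite /zval /= => h.
rewrite /weq /zy /zx /=.
have -> : f0 = - (e * z ^+ 2 + (r2 * X ^+ 2 + r1 * X + r0) * z
                 + (f3 * X ^+ 3 + f2 * X ^+ 2 + f1 * X)).
  by apply/eqP; rewrite -subr_eq0 opprK -[0]h; apply/eqP; ring.
ring.
Qed.

Lemma zyE c X z : X * (zr2 c ^+ 2 * zx c X z - za0 c)
  = zr2 c * zy c X z + ze c * zf3 c * zx c X z.
Proof. by rewrite /zy /zx /za0; ring. Qed.

(** Eliminating z through [zx] leaves a quadratic equation for X over K(x), which determines X where
    [zyE] degenerates to 0 = 0. *)
Lemma zquad c X z :
  let x := zx c X z in
  let b := (zr1 c * zr2 c - 2 * ze c * zf3 c) * x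
    + ze c * (zr0 c * zr2 c * zf3 c - zr2 c ^+ 2 * zf1 c) in
  (zr2 c ^+ 2 * x - za0 c) * X ^+ 2 + b * X
  + (zr0 c * zr2 c * x - x ^+ 2 - zr2 c ^+ 2 * (ze c * zf0 c))
  = - (zr2 c ^+ 2 * ze c * zval c X z).
Proof. by rewrite /zx /za0 /zval /=; ring. Qed.

End ZRing.

Section Morph.
Variables (R S : comNzRingType) (f : {rmorphism R -> S}).

Lemma zw_map c : zw (zmap f c) = wmap f (zw c).
Proof. by rewrite /zw /wmap /=; congr Weier; ring. Qed.

Lemma zdisc_map c : disc (zw (zmap f c)) = f (disc (zw c)).
Proof. by rewrite /disc /=; ring. Qed.

Lemma zinv4_map c : inv4 (zw (zmap f c)) = f (inv4 (zw c)).
Proof. by rewrite /inv4 /=; ring. Qed.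

Lemma disc_map w : disc (wmap f w) = f (disc w).
Proof. by rewrite /disc /=; ring. Qed.

End Morph.

(* The quadratic [zquad] satisfied by X over K(x) cannot vanish identically on a
   smooth curve: all its coefficients would vanish at a singular point. *)
Lemma zquad_nondeg (K : fieldType) (c : zcubic K) (x : K) : disc (zw c) != 0 ->
  zr2 c ^+ 2 * x = za0 c -> zr2 c != 0 ->
  (zr1 c * zr2 c - 2 * ze c * zf3 c) * x
    + ze c * (zr0 c * zr2 c * zf3 c - zr2 c ^+ 2 * zf1 c) = 0 ->
  zr0 c * zr2 c * x - x ^+ 2 - zr2 c ^+ 2 * (ze c * zf0 c) != 0.
Proof.
case: c => e r2 r1 r0 f3 f2 f1 f0 d /= /eqP; rewrite -subr_eq0 => /eqP ea r2n eb.
apply: contraNneq d => ec; apply/eqP.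
pose y := - (e * f3 * x) / r2.
have ey : r2 * y + e * f3 * x = 0 by rewrite /y mulrC divfK // addNr.
have r2n2 : r2 ^+ 2 != 0 by rewrite expf_eq0.
apply: (@disc_singular _ _ x y).
- apply/(mulfI r2n2); rewrite mulr0.
  transitivity ((r2 * y + e * f3 * x) ^+ 2
    + ((r1 * r2 - 2 * e * f3) * x + e * (r0 * r2 * f3 - r2 ^+ 2 * f1))
      * (r2 * y + e * f3 * x)
    + (r2 ^+ 2 * x - za0 (ZCubic e r2 r1 r0 f3 f2 f1 f0))
      * (r0 * r2 * x - x ^+ 2 - r2 ^+ 2 * (e * f0))).
    by rewrite /weq /za0 /=; ring.
  by rewrite ey ea; ring.
- apply/(mulfI r2n); rewrite mulr0.
  transitivity (2 * (r2 * y + e * f3 * x)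
    + ((r1 * r2 - 2 * e * f3) * x + e * (r0 * r2 * f3 - r2 ^+ 2 * f1))).
    by rewrite /=; ring.
  by rewrite ey eb; ring.
- apply/(mulfI r2n2); rewrite mulr0.
  transitivity (- (2 * e * f3 + (r1 * r2 - 2 * e * f3)) * (r2 * y + e * f3 * x)
    - ((r1 * r2 - 2 * e * f3) * x + e * (r0 * r2 * f3 - r2 ^+ 2 * f1)) * (e * f3)
    - r2 ^+ 2 * (r0 * r2 * x - x ^+ 2 - r2 ^+ 2 * (e * f0))
    - (r2 ^+ 2 * x - za0 (ZCubic e r2 r1 r0 f3 f2 f1 f0)) * (r0 * r2 - 2 * x)).
    by rewrite /za0 /=; ring.
  by rewrite ey ea eb ec; ring.
Qed.

(** * Points and subfields of an abelian extension *)

Section Abelian.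
Variables (K : fieldType) (L : splittingFieldType K).
Hypothesis L_abelian : abelian_extension L.
Implicit Types F G : {subfield L}.

Local Notation "''Gal' ( V / U )" := (galoisG V U) : ring_scope.
Local Notation Gamma := 'Gal({:L} / 1).

Lemma gal_full : galois 1%AS {:L}%AS. Proof. by case/andP: L_abelian. Qed.

Lemma abelian_full : abelian Gamma. Proof. by case/andP: L_abelian. Qed.

Lemma galois_sup F : galois F {:L}.
Proof. by apply: galoisS gal_full; rewrite sub1v subvf. Qed.

Lemma galois_sub F : galois 1%AS F.
Proof.
have nF : ('Gal({:L} / F) <| Gamma)%g.
  rewrite -sub_abelian_normal ?galS ?sub1v //; exact: abelian_full.
have := normal_fixedField_galois gal_full nF.
by rewrite (galois_fixedField (galois_sup F)).
Qed.

Lemma gal_expg_dim F h : h \in Gamma -> (h ^+ \dim F)%g \in 'Gal({:L} / F).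
Proof.
move=> hG; have sAG : 'Gal({:L} / F) \subset Gamma by rewrite galS ?sub1v.
have nA : ('Gal({:L} / F) <| Gamma)%g.
  by rewrite -sub_abelian_normal //; apply: abelian_full.
have -> : \dim F = #|Gamma : 'Gal({:L} / F)|%g.
  rewrite -(dim_fixed_galois gal_full) //.
  by rewrite (galois_fixedField (galois_sup F)) dimv1 divn1.
have hN : h \in ('N('Gal({:L} / F)))%g by rewrite (fintype.subsetP (normal_norm nA)).
apply: coset_idr; first exact: groupX.
rewrite morphX //= -card_quotient ?normal_norm //.
by apply: expg_cardG; rewrite mem_quotient.
Qed.

Lemma subfield_coprime F1 F2 G : coprime (\dim F1) (\dim F2) ->
  (F1 <= G * F2)%VS -> (F2 <= G * F1)%VS -> (F1 <= G)%VS.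
Proof.
move=> co s1 s2; rewrite -(galois_fixedField (galois_sup G)).
apply/subvP => a aF1; apply/fixedFieldP; first exact: memvf.
move=> h hG; have hGam : h \in Gamma by apply: (fintype.subsetP _ _ hG); rewrite galS ?sub1v.
suff hF1 : h \in 'Gal({:L} / F1) by rewrite (fixed_gal _ hF1) ?subvf.
have h1 := gal_expg_dim F1 hGam.
have h2 : (h ^+ \dim F2)%g \in 'Gal({:L} / F1).
  have h2 := gal_expg_dim F2 hGam.
  rewrite -[_ \in _]finset.sub1set galois_connection ?subvf //.
  apply: subv_trans s1 _; apply: prodv_sub.
    by rewrite -galois_connection ?subvf // finset.sub1set groupX.
  by rewrite -galois_connection ?subvf // finset.sub1set.
have [km kn e _] := egcdnP (\dim F2) (adim_gt0 F1).
have: (h ^+ (km * \dim F1))%g \in 'Gal({:L} / F1) by rewrite mulnC expgM groupX.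
rewrite e (eqP co) expgD expg1 mulnC expgM groupMl //.
by rewrite groupX.
Qed.

(** Take the fixed field of the Hall subgroup for the complementary primes, which in a nilpotent
    group is a core. *)
Lemma subfield_partn (pi : nat_pred) :
  exists F, \dim F = ((\dim {:L})`_pi)%N.
Proof.
pose H := 'O_pi^'(Gamma)%G.
have hallH : ((pi^').-Hall(Gamma) H)%g.
  by apply: nilpotent_pcore_Hall; apply: abelian_nil; apply: abelian_full.
exists (fixedField_aspace H).
have := dim_fixed_galois gal_full (pHall_sub hallH).
rewrite /= dimv1 divn1 => ->.
have cG : #|Gamma| = \dim {:L} by rewrite -galois_dim ?gal_full // dimv1 divn1.
rewrite -divgS ?(pHall_sub hallH) // (card_Hall hallH) cG.
by rewrite -{1}(partnC pi (adim_gt0 {:L})) mulnK // part_gt0.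
Qed.

Lemma subfield_half F : \dim F = 4%N -> exists F2, (F2 <= F)%VS /\ \dim F2 = 2%N.
Proof.
move=> dF; have gF := galois_sub F.
have cF : #|'Gal(F / 1)| = 4%N by rewrite -galois_dim // dimv1 divn1.
have [||x xG ox] := @Cauchy _ 2 'Gal(F / 1)%G _ _; rewrite ?cF //.
exists (fixedField_aspace <[x]>%G); split; first exact: fixedField_bound.
have sx : (<[x]> \subset 'Gal(F / 1))%g by rewrite cycle_subG.
have := dim_fixed_galois gF sx; rewrite /= dimv1 divn1 => ->.
by rewrite -divgS //= cF -orderE ox.
Qed.

Lemma subfield_gen F : exists2 a, a \in F & (F <= <<1; a>>)%VS.
Proof.
have /and3P[_ sepF _] := galois_sub F.
exists (separable_generator 1 F); first exact: separable_generator_mem.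
exact: sub_adjoin_separable_generator.
Qed.

End Abelian.

Section Points.
Variables (K : fieldType) (L : splittingFieldType K).
Implicit Types (E : elliptic_curve K) (F G : {subfield L}) (P : curve_point L).

Definition wcurve (w : weier K) : weierstrass K :=
  Weierstrass (w1 w) (w2 w) (w3 w) (w4 w) (w6 w).

(** F is exactly the field of definition of P, expressed by minimality among the subfields of L. The
    point at infinity qualifies only for F = K. *)
Definition point_field E F P :=
  [/\ on_curve E P, coords_in F P &
      forall G, coords_in G P -> (F <= G)%VS].

Definition weier_of E : weier K :=
  Weier (wa1 E) (wa2 E) (wa3 E) (wa4 E) (wa6 E).

Lemma on_affineE E (x y : L) :
  on_curve E (Affine x y) <-> weq (wmap (in_alg L) (weier_of E)) x y = 0.
Proof.
rewrite /on_curve /weq /= !mulr_algl.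
by split=> [->|/eqP]; [rewrite subrr | rewrite subr_eq0 => /eqP].
Qed.

Lemma point_field_new E P : point_field E {:L} P -> has_new_point L E.
Proof.
move=> [onP cP genP]; exists P; split; first by split.
case=> G /= nG [_ cG]; case/eqP: nG.
by apply/val_inj/eqP; rewrite eqEsubv subvf; apply: genP.
Qed.

Lemma alg_mem (G : {subfield L}) (k : K) : k%:A \in G.
Proof. by rewrite rpredZ ?mem1v. Qed.

Lemma mem1P (a : L) : reflect (exists k : K, a = k%:A) (a \in 1%VS).
Proof. exact: (vlineP a 1). Qed.

End Points.

Ltac solve_mem :=
  repeat first [ assumption | exact: mem1v | exact: rpred_nat | exact: rpred1
    | exact: rpred0 | exact: alg_mem
    | match goal with
      | |- is_true (_ + _ \in _) => apply: rpredD
      | |- is_true (- _ \in _) => rewrite rpredN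
      | |- is_true (_ * _ \in _) => apply: rpredM
      | |- is_true (_ ^+ _ \in _) => apply: rpredX
      | |- is_true (_^-1 \in _) => rewrite rpredV
      end ].

(** * The third point of a chord *)

Section Chord.
Variables (L : fieldType) (w : weier L) (x1 y1 x2 y2 : L).
Hypotheses (on1 : weq w x1 y1 = 0) (on2 : weq w x2 y2 = 0) (nx : x1 != x2).

Definition slope := (y2 - y1) / (x2 - x1).
Definition x3 := slope ^+ 2 + w1 w * slope - w2 w - x1 - x2.
(** This is the third intersection itself, not its negative for the group law; both generate the
    same field, and this one keeps the three points on one line. *)
Definition y3 := slope * (x3 - x1) + y1.

Let dx : x2 - x1 != 0. Proof. by rewrite subr_eq0 eq_sym. Qed.

Lemma slopeE : y2 = y1 + slope * (x2 - x1).
Proof. by rewrite /slope divfK // addrC subrK. Qed.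

(** Subtract the two equations and divide by x2 - x1. Once a4 is eliminated this way, and a6 by the
    equation at the first point, the remaining claims are polynomial identities. *)
Lemma chord_a4 : w4 w = y1 * w1 w + slope * (w3 w + 2 * y1 + w1 w * x2)
  + slope ^+ 2 * (x2 - x1) - (x1 ^+ 2 + x1 * x2 + x2 ^+ 2) - w2 w * (x1 + x2).
Proof.
apply/eqP; rewrite -subr_eq0 -(mulrI_eq0 _ (mulfI dx)); apply/eqP.
transitivity (weq w x1 y1 - weq w x2 y2); last by rewrite on1 on2 subrr.
by rewrite [in RHS]slopeE /weq; move: slope => s; ring.
Qed.

Lemma chord_on : weq w x3 y3 = 0.
Proof.
have e6 : w6 w = y1 ^+ 2 + w1 w * (x1 * y1) + w3 w * y1
    - (x1 ^+ 3 + w2 w * x1 ^+ 2 + w4 w * x1).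
  by apply/eqP; rewrite -subr_eq0 -oppr_eq0 -on1 /weq; apply/eqP; ring.
rewrite /weq e6 chord_a4 /y3 /x3; move: slope => s; ring.
Qed.

(** If the third intersection coincides with the second point, the chord is tangent there. *)
Lemma chord_tangent : x3 = x2 ->
  slope * (2 * y2 + w1 w * x2 + w3 w)
    = 3 * x2 ^+ 2 + 2 * w2 w * x2 + w4 w - w1 w * y2.
Proof.
move=> e; have e1 : x1 = slope ^+ 2 + w1 w * slope - w2 w - 2 * x2.
  apply/eqP; rewrite -subr_eq0; apply/eqP.
  transitivity (x2 - x3); last by rewrite e subrr.
  by rewrite /x3; ring.
rewrite chord_a4; move: slope slopeE e1 => s -> ->; ring.
Qed.

Lemma chord_x1 : x1 = slope ^+ 2 + w1 w * slope - w2 w - x2 - x3.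
Proof. by rewrite /x3; ring. Qed.

Lemma chord_y1 : y1 = y2 - slope * (x2 - x1).
Proof. by rewrite [in RHS]slopeE addrK. Qed.

Lemma chord_slope : x3 != x2 -> slope = (y3 - y2) / (x3 - x2).
Proof.
move=> n; have n' : x3 - x2 != 0 by rewrite subr_eq0.
apply: (mulIf n'); rewrite divfK // /y3 [in RHS]slopeE; move: slope => s; ring.
Qed.

Lemma tangent_slope : disc w != 0 -> x3 = x2 ->
  slope = (3 * x2 ^+ 2 + 2 * w2 w * x2 + w4 w - w1 w * y2)
          / (2 * y2 + w1 w * x2 + w3 w).
Proof.
move=> d /chord_tangent e; have n : 2 * y2 + w1 w * x2 + w3 w != 0.
  apply: contraNneq d => z; move: e; rewrite z mulr0 => /esym e'.
  by apply/eqP/(disc_singular on2).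
by rewrite -e mulfK.
Qed.

End Chord.

Section Combine.
Variables (K : fieldType) (L : splittingFieldType K).
Hypothesis L_abelian : abelian_extension L.
Implicit Types (E : elliptic_curve K) (F G : {subfield L}).

Section ChordField.
Variables (w : weier K) (x1 y1 x2 y2 : L).
Let wL := wmap (in_alg L) w.
Hypotheses (on1 : weq wL x1 y1 = 0) (on2 : weq wL x2 y2 = 0) (nx : x1 != x2).
Hypothesis d : disc w != 0.

Let mw1 G : w1 wL \in G. Proof. exact: alg_mem. Qed.
Let mw2 G : w2 wL \in G. Proof. exact: alg_mem. Qed.
Let mw3 G : w3 wL \in G. Proof. exact: alg_mem. Qed.
Let mw4 G : w4 wL \in G. Proof. exact: alg_mem. Qed.

Lemma mem_chord G : x1 \in G -> y1 \in G -> x2 \in G -> y2 \in G ->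
  x3 wL x1 y1 x2 y2 \in G /\ y3 wL x1 y1 x2 y2 \in G.
Proof.
move=> hx1 hy1 hx2 hy2; have m1 := mw1 G; have m2 := mw2 G.
have hs : slope x1 y1 x2 y2 \in G by rewrite /slope; solve_mem.
have hx : x3 wL x1 y1 x2 y2 \in G by rewrite /x3; solve_mem.
by split=> //; rewrite /y3; solve_mem.
Qed.

(** The chord is also the line through the second and third points, or the tangent at the second if
    they coincide. Its slope therefore lies in G, and so does the first point. *)
Lemma mem_chord_recover G :
  x3 wL x1 y1 x2 y2 \in G -> y3 wL x1 y1 x2 y2 \in G ->
  x2 \in G -> y2 \in G -> x1 \in G /\ y1 \in G.
Proof.
move=> hx3 hy3 hx2 hy2; have m1 := mw1 G; have m2 := mw2 G.
have m3 := mw3 G; have m4 := mw4 G.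
have hs : slope x1 y1 x2 y2 \in G.
  have [e|n] := eqVneq (x3 wL x1 y1 x2 y2) x2.
    have dL : disc wL != 0 by rewrite disc_map fmorph_eq0.
    by rewrite (tangent_slope on1 on2 nx dL e); solve_mem.
  by rewrite (chord_slope nx n); solve_mem.
have hx1 : x1 \in G by rewrite (chord_x1 wL x1 y1 x2 y2); solve_mem.
by split=> //; rewrite (chord_y1 y1 y2 nx); solve_mem.
Qed.
End ChordField.

Lemma chord_sym (w : weier L) x1 y1 x2 y2 : x1 != x2 ->
  x3 w x1 y1 x2 y2 = x3 w x2 y2 x1 y1 /\ y3 w x1 y1 x2 y2 = y3 w x2 y2 x1 y1.
Proof.
move=> nx; have es : slope x1 y1 x2 y2 = slope x2 y2 x1 y1.
  by rewrite /slope -[y2 - y1]opprB -[x2 - x1]opprB invrN mulrNN.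
have ex : x3 w x1 y1 x2 y2 = x3 w x2 y2 x1 y1 by rewrite /x3 es; move: (slope _ _ _ _) => s; ring.
split=> //; rewrite /y3 -ex -es.
have := slopeE y1 y2 nx; move: (slope _ _ _ _) (x3 _ _ _ _ _) => s x ->; ring.
Qed.

(* A nonvertical chord cannot degenerate: a common abscissa would be rational,
   and a point with rational abscissa generates an extension of degree <= 2. *)
Lemma dim_rational_abscissa E F x y : point_field E F (Affine x y) ->
  x \in 1%VS -> (\dim F <= 2)%N.
Proof.
move=> [/on_affineE on _ gen] x1.
pose w := weier_of E.
have /polyOver1P[p pE] : 'X^2 + ((wa1 E)%:A * x + (wa3 E)%:A) *: 'X
    - (x ^+ 3 + (wa2 E)%:A * x ^+ 2 + (wa4 E)%:A * x + (wa6 E)%:A)%:P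
    \is a polyOver (1%VS : {vspace L}).
  rewrite rpredB ?rpredD ?polyOverZ ?rpredX ?polyOverX ?polyOverC //;
  by rewrite !(rpredD, rpredM, rpredX) ?(alg_mem 1%AS).
set q := (X in X = _) in pE.
have sq : size q = 3%N.
  rewrite /q -addrA size_polyDl size_polyXn // ltnS.
  apply: leq_trans (size_polyD _ _) _; rewrite geq_max size_polyN.
  rewrite (leq_trans (size_scale_leq _ _)) ?size_polyX //.
  by rewrite (leq_trans (size_polyC_leq1 _)).
have dq : minPoly 1 y %| q.
  rewrite minPoly_dvdp //; first by rewrite pE; apply/polyOver1P; exists p.
  rewrite /root /q !hornerE -on /weq /=; apply/eqP; ring.
have sm : (size (minPoly 1 y) <= 3)%N.
  by rewrite -sq dvdp_leq // -size_poly_eq0 sq.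
have sF : (F <= <<1; y>>)%VS.
  apply: gen; apply/andP; split; last exact: memv_adjoin.
  by apply: subvP x1; apply: sub1v.
apply: leq_trans (dimvS sF) _.
rewrite dim_Fadjoin dimv1 muln1.
by move: sm; rewrite size_minPoly ltnS.
Qed.

Lemma point_field_chord E F1 F2 P1 P2 :
  coprime (\dim F1) (\dim F2) -> (2 < \dim F2)%N -> (1 < \dim F1)%N ->
  point_field E F1 P1 -> point_field E F2 P2 ->
  exists P, point_field E (F1 * F2)%AS P.
Proof.
move=> co d2 d1; case: P1 => [[_ _ /(_ 1%AS isT)/dimvS]|x1 y1 pf1].
  by rewrite dimv1 leqNgt d1.
case: P2 => [[_ _ /(_ 1%AS isT)/dimvS]|x2 y2 pf2].
  by rewrite dimv1 leqNgt (ltn_trans _ d2).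
have [/on_affineE on1 /andP[x1F y1F] g1] := pf1.
have [/on_affineE on2 /andP[x2F y2F] g2] := pf2.
have dE : disc (weier_of E) != 0 by apply: (wdisc_neq0 E).
have nx : x1 != x2.
  apply: contraTneq d2 => ex; rewrite -leqNgt.
  apply: (dim_rational_abscissa pf2); rewrite -ex.
  have: x1 \in (F1 :&: F2)%VS by rewrite memv_cap x1F ex x2F.
  suff -> : (F1 :&: F2 = 1)%VS by [].
  apply/eqP; rewrite eq_sym eqEdim sub1v dimv1.
  have := dvdn_gcd (\dim (F1 :&: F2)) (\dim F1) (\dim F2).
  by rewrite (eqP co) !field_dimS ?capvSl ?capvSr // dvdn1 => /eqP ->.
set wL := wmap _ _ in on1 on2.
have FS1 : (F1 <= F1 * F2)%VS by apply: field_subvMr.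
have FS2 : (F2 <= F1 * F2)%VS by apply: field_subvMl.
exists (Affine (x3 wL x1 y1 x2 y2) (y3 wL x1 y1 x2 y2)); split.
- by apply/on_affineE; apply: chord_on.
- apply/andP/mem_chord; first [exact: subvP FS1 _ x1F | exact: subvP FS1 _ y1F
    | exact: subvP FS2 _ x2F | exact: subvP FS2 _ y2F].
move=> G /andP[hx3 hy3].
have s1 : (F1 <= G * F2)%VS.
  apply: (g1 (G * F2)%AS) => /=.
  have sG : (G <= G * F2)%VS by apply: field_subvMr.
  have sF : (F2 <= G * F2)%VS by apply: field_subvMl.
  exact/andP/(mem_chord_recover on1 on2 nx dE
    (subvP sG _ hx3) (subvP sG _ hy3) (subvP sF _ x2F) (subvP sF _ y2F)).
have s2 : (F2 <= G * F1)%VS.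
  apply: (g2 (G * F1)%AS) => /=.
  have sG : (G <= G * F1)%VS by apply: field_subvMr.
  have sF : (F1 <= G * F1)%VS by apply: field_subvMl.
  have nx' : x2 != x1 by rewrite eq_sym.
  have [ex ey] := chord_sym wL y1 y2 nx.
  move: hx3 hy3; rewrite ex ey => hx3 hy3.
  exact/andP/(mem_chord_recover on2 on1 nx' dE
    (subvP sG _ hx3) (subvP sG _ hy3) (subvP sF _ x1F) (subvP sF _ y1F)).
apply: prodv_sub; first exact: (subfield_coprime L_abelian co).
by apply: (subfield_coprime L_abelian (F1 := F2) (F2 := F1)); rewrite // coprime_sym.
Qed.

End Combine.

(** * Generating points on the cubic, and families with a nodal member *)

Section ZPoints.
Variables (K : fieldType) (L : splittingFieldType K).
Implicit Types (F G : {subfield L}) (c : zcubic K).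

Definition zcurve c (d : disc (zw c) != 0) : elliptic_curve K :=
  @EllipticCurve K (wcurve (zw c)) d.

(** No field is lost in passing to Weierstrass coordinates: X is recovered from [zyE], or from
    [zquad] where that degenerates, and then z from [zx], or from [zy] when r2 = 0. *)
Lemma zpoint c (d : disc (zw c) != 0) F (X z : L) :
  let cL := zmap (in_alg L) c in
  zval cL X z = 0 -> X \in F -> z \in F ->
  (forall G, X \in G -> z \in G -> (F <= G)%VS) ->
  point_field (zcurve d) F (Affine (zx cL X z) (zy cL X z)).
Proof.
move=> cL on XF zF gen.
have wE : wmap (in_alg L) (weier_of (zcurve d)) = zw cL by rewrite zw_map.
have dL : disc (zw cL) != 0 by rewrite /cL zdisc_map fmorph_eq0.
have mem G : [/\ ze cL \in G, zr2 cL \in G, zr1 cL \in G & zr0 cL \in G] /\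
             [/\ zf3 cL \in G, zf2 cL \in G, zf1 cL \in G & zf0 cL \in G].
  by split; split; apply: alg_mem.
clearbody cL; split; first by apply/on_affineE; rewrite wE; apply: zw_on.
  have [[? ? ? ?] [? ? ? ?]] := mem F.
  by apply/andP; rewrite /zy /zx; split; solve_mem.
move=> G /andP[]; have /= := zquad cL X z; have := zyE cL X z; rewrite on mulr0 oppr0.
have e0 : ze cL != 0.
  by apply: contraNneq dL => e0; apply/eqP; rewrite /disc /= e0; ring.
have r20 : zr2 cL = 0 -> zf3 cL != 0.
  move=> r0; apply: contraNneq dL => f0; apply/eqP.
  by rewrite /disc /= r0 f0; ring.
have [[eG r2G r1G r0G] [f3G f2G f1G f0G]] := mem G.
have zE : zr2 cL != 0 -> z = - (zx cL X z / ze cL + zf3 cL * X) / zr2 cL.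
  move=> r2n; apply: (mulIf r2n); rewrite divfK // /zx mulNr opprD.
  by rewrite mulrAC mulfV // mul1r; ring.
have zE' : zr2 cL = 0 -> z = (zy cL X z - ze cL * zr1 cL * zf3 cL * X)
    / (ze cL ^+ 2 * zf3 cL).
  move=> r2z; have n : ze cL ^+ 2 * zf3 cL != 0.
    by rewrite mulf_neq0 ?expf_neq0 ?r20.
  by apply: (mulIf n); rewrite divfK // /zy r2z; ring.
move: zE zE'; set x := zx _ _ _; set y := zy _ _ _ => zE zE' eX eQ xG yG.
have aG : za0 cL \in G by rewrite /za0; solve_mem.
suff XG : X \in G.
  apply: gen => //; have [r2z|r2n] := eqVneq (zr2 cL) 0.
    by rewrite (zE' r2z); solve_mem.
  by rewrite (zE r2n); solve_mem.
have [ea|na] := eqVneq (zr2 cL ^+ 2 * x) (za0 cL); last first.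
  have -> : X = (zr2 cL * y + ze cL * zf3 cL * x) / (zr2 cL ^+ 2 * x - za0 cL).
    by rewrite -eX mulfK // subr_eq0.
  by solve_mem.
have r2n : zr2 cL != 0.
  apply/eqP => r2z; move: (ea) => /eqP; apply/negP.
  have -> : za0 cL = ze cL ^+ 2 * zf3 cL ^+ 2 by rewrite /za0 r2z; ring.
  by rewrite r2z expr0n mul0r eq_sym mulf_neq0 ?expf_neq0 ?r20.
have nd := zquad_nondeg dL ea r2n.
move: eQ nd; rewrite ea subrr mul0r add0r.
set b := _ + ze cL * _; set q := _ - _ * (_ * _) => eQ nd.
have bn : b != 0.
  by apply/eqP => bz; move/eqP: eQ; rewrite bz mul0r add0r; apply/negP; apply: nd.
have -> : X = - q / b.
  by apply: (mulIf bn); rewrite divfK // mulrC; apply/eqP; rewrite -addr_eq0; apply/eqP.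
by rewrite /q /b; solve_mem.
Qed.

Lemma finite_roots (M : fieldType) (iota : {rmorphism K -> M}) (p : {poly M}) :
  p != 0 -> finite_set [set t : K | p.[iota t] = 0]%classic.
Proof.
move=> p0; apply: contrapT => /(infinite_set_fset (size p))[B sB].
rewrite leqNgt => /negP; apply.
have := @max_poly_roots _ p (map iota (enum_fset B)) p0.
rewrite size_map; apply.
  by apply/allP => _ /mapP[t tB ->]; apply/rootP; apply: sB.
by rewrite map_inj_uniq ?fset_uniq //; apply: fmorph_inj.
Qed.

(** The parameters t giving a fixed value j are roots of c4^3 - j disc. At t1 this polynomial equals
    c4^3, which is nonzero, so each j arises from finitely many t. The field M allows a nodal
    parameter t1 outside K. *)
Lemma infinite_family (M : fieldType) (iota : {rmorphism K -> M}) (T : set K)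
    (c : zcubic {poly M}) (t1 : M) :
  infinite_set T -> disc (zw c) != 0 ->
  (disc (zw c)).[t1] = 0 -> (inv4 (zw c)).[t1] != 0 ->
  (forall t, T t -> exists c0 : zcubic K,
     zmap iota c0 = zmap (horner_eval (iota t)) c /\
     forall d : disc (zw c0) != 0, has_new_point L (zcurve d)) ->
  exists S : set (elliptic_curve K),
    [/\ infinite_set S, set_inj S (@j_invariant K) &
        forall E : elliptic_curve K, S E -> has_new_point L E].
Proof.
move=> infT d0 dt1 c4t1 fam; set p := inv4 (zw c); set q := disc (zw c).
pose good (E : elliptic_curve K) t :=
  [/\ T t, q.[iota t] != 0, has_new_point L E
    & iota (j_invariant E) * q.[iota t] = p.[iota t] ^+ 3].
pose J := [set j : K | exists E t, good E t /\ j_invariant E = j]%classic.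
have ex t : T t -> q.[iota t] != 0 -> exists E, good E t.
  move=> Tt qt; have [c0 [e new]] := fam t Tt.
  have dE : iota (disc (zw c0)) = q.[iota t].
    by rewrite -zdisc_map e zdisc_map.
  have d : disc (zw c0) != 0 by rewrite -(fmorph_eq0 iota) dE.
  exists (zcurve d); split=> //.
  rewrite -dE -rmorphM; transitivity (iota (inv4 (zw c0) ^+ 3)).
    by congr (iota _); rewrite /j_invariant divfK.
  by rewrite rmorphXn -zinv4_map e zinv4_map.
have infJ : infinite_set J.
  move=> finJ; apply: infT.
  have : finite_set ([set t : K | q.[iota t] = 0] `|`
     \bigcup_(j in J) [set t : K | (p ^+ 3 - (iota j)%:P * q).[iota t] = 0])%classic.
    rewrite finite_setU; split; first exact: finite_roots.
    apply: bigcup_finite => // j _; apply: finite_roots.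
    apply: contraNneq c4t1 => /(congr1 (horner^~ t1)).
    rewrite hornerD hornerN horner_exp hornerM hornerC horner0 dt1 mulr0 subr0 => /eqP; rewrite expf_eq0 /=; exact.
  apply: sub_finite_set => t Tt.
  have [qt|qt] := eqVneq q.[iota t] 0; [by left | right].
  have [E gE] := ex t Tt qt; exists (j_invariant E); first by exists E, t.
  by case: gE => _ _ _ eE /=; rewrite hornerD hornerN horner_exp hornerM hornerC eE subrr.
have [j0 [E0 _]] := infinite_setN0 infJ.
(* One curve is kept for each j; [E0] is only a default value for j outside [J]. *)
have /choice[g gP] : forall j, exists E, J j -> has_new_point L E /\ j_invariant E = j.
  move=> j; have [[E [t [[_ _ nE _] <-]]]|nJ] := pselect (J j).
    by exists E.
  by exists E0.
exists (g @` J)%classic; split.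
- move=> finS; apply: infJ.
  have := finite_image (@j_invariant K) finS; apply: sub_finite_set => j Jj.
  by exists (g j); [exists j | case: (gP j Jj)].
- move=> E E' /set_mem[j Jj <-] /set_mem[j' Jj' <-].
  by rewrite (gP j Jj).2 (gP j' Jj').2 => ->.
- by move=> E [j Jj <-]; case: (gP j Jj).
Qed.

End ZPoints.

(** * Degenerations with two nodes *)

Section Nodal.
Variables (R : comNzRingType).
Implicit Types c : zcubic R.

Definition disc_cofactor c : R :=
  let a1 := zr1 c in
  let a2 := - (ze c * zf2 c + zr0 c * zr2 c) in
  let a3 := zr0 c * zf3 c - zr2 c * zf1 c in
  let a4 := zr0 c * zr2 c * zf2 c - zr0 c * zr1 c * zf3 c
             + zr2 c ^+ 2 * zf0 c + ze c * zf1 c * zf3 c in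
  let a6 := - ((zr2 c ^+ 2 * zf2 c + ze c * zf3 c ^+ 2
             - zr1 c * zr2 c * zf3 c) * zf0 c) in
  let b2 := a1 ^+ 2 + 4 * a2 in
  let b4 := 2 * a4 + a1 * a3 in
  let b6 := a3 ^+ 2 + 4 * a6 in
  let b8 := b2 * a6 - a1 * a3 * a4 + a2 * a3 ^+ 2 - a4 ^+ 2 in
  - (b2 ^+ 2 * b8)
  + ze c * (9 * b2 * b4 * b6 - 8 * b4 ^+ 3 - 27 * ze c * b6 ^+ 2).

Lemma disc_cofactorE c : disc (zw c) = ze c ^+ 2 * disc_cofactor c.
Proof. by rewrite /disc /disc_cofactor /=; ring. Qed.

End Nodal.

Lemma disc_cofactor_map (R S : comNzRingType) (f : {rmorphism R -> S}) c :
  disc_cofactor (zmap f c) = f (disc_cofactor c).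
Proof. by rewrite /disc_cofactor /=; ring. Qed.

(* At t = 0 the curve becomes the union of z = infinity and of
   X(1 - X) z + f(X) = 0, which meet above X = 0 and X = 1; f does not vanish
   there, so the discriminant vanishes to order exactly 2. *)
Definition two_nodes (K : fieldType) (c : zcubic {poly K}) :=
  [/\ ze c = 'X,
      [/\ (zr2 c).[0] = -1, (zr1 c).[0] = 1 & (zr0 c).[0] = 0],
      (zf0 c).[0] != 0
    & (zf3 c).[0] + (zf2 c).[0] + (zf1 c).[0] + (zf0 c).[0] != 0].

Lemma infinite_two_nodes (K : fieldType) (L : splittingFieldType K)
    (T : set K) (c : zcubic {poly K}) :
  infinite_set T -> two_nodes c ->
  (forall t, T t -> forall d : disc (zw (zmap (horner_eval t) c)) != 0,
     has_new_point L (zcurve d)) ->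
  exists S : set (elliptic_curve K),
    [/\ infinite_set S, set_inj S (@j_invariant K) &
        forall E : elliptic_curve K, S E -> has_new_point L E].
Proof.
move=> infT [ce [cr2 cr1 cr0] cf0 cf1] new.
have e0 : horner_eval 0 (ze c) = 0 by rewrite ce /horner_eval hornerX.
apply: (@infinite_family _ _ _ idfun T c 0) => //.
- rewrite disc_cofactorE ce mulf_neq0 ?expf_neq0 ?polyX_eq0 //.
  (* At t = 0 the cofactor is the product of the values at X = 0 and X = 1 of the part of the cubic
     free of z. *)
  apply: contraNneq (mulf_neq0 cf0 cf1) => D0.
  have := disc_cofactor_map (horner_eval 0) c; rewrite D0 rmorph0.
  rewrite /disc_cofactor /= e0 /horner_eval cr2 cr1 cr0 => D.
  by apply/eqP; rewrite -[RHS]D; ring.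
- by rewrite -[LHS]/(horner_eval 0 _) -zdisc_map disc_cofactorE /= e0; ring.
- rewrite -[_.[0]]/(horner_eval 0 _) -zinv4_map /inv4 /= e0 /horner_eval.
  rewrite cr2 cr1 cr0.
  by match goal with |- is_true (?a != 0) => have -> : a = 1 by ring end;
    exact: oner_neq0.
- move=> t Tt; exists (zmap (horner_eval t) c); split; last exact: new.
  by [].
Qed.

Lemma infinite_fibers (T U : Type) (A : set T) (phi : T -> U) :
  infinite_set A -> (forall y, finite_set [set s | A s /\ phi s = y]%classic) ->
  infinite_set (phi @` A)%classic.
Proof.
move=> infA fib finI; apply: infA.
have : finite_set (\bigcup_(y in (phi @` A)) [set s | A s /\ phi s = y])%classic.
  exact: bigcup_finite.
by apply: sub_finite_set => s As; exists (phi s); [exists s|].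
Qed.

(** * Generators of subfields and norm forms *)

Section Gen.
Variables (K : fieldType) (L : splittingFieldType K).
Hypothesis L_abelian : abelian_extension L.
Implicit Types (F G : {subfield L}) (a u : L).

Definition generates F a := a \in F /\ forall G, a \in G -> (F <= G)%VS.

Lemma generatesP F a : a \in F -> (F <= <<1; a>>)%VS -> generates F a.
Proof.
move=> aF sF; split=> // G aG; apply: subv_trans sF _.
by apply/FadjoinP; rewrite sub1v.
Qed.

Lemma generates_ex F : exists a, generates F a.
Proof.
have [a aF sF] := subfield_gen L_abelian F.
by exists a; apply: generatesP.
Qed.

Lemma generates_notin F a : generates F a -> (1 < \dim F)%N -> a \notin 1%VS.
Proof.
move=> [_ g] d; apply: contraL d => a1; rewrite -leqNgt.
by rewrite (leq_trans (dimvS (g 1%AS a1))) // dimv1.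
Qed.

Lemma generates_prime F a : prime (\dim F) -> a \in F -> a \notin 1%VS ->
  generates F a.
Proof.
move=> pF aF a1; apply: generatesP => //.
have sF : (<<1; a>> <= F)%VS by apply/FadjoinP; rewrite sub1v.
have := (primeP pF).2 _ (field_dimS sF); case/orP=> /eqP e.
  case/negP: a1; suff <- : (<<1; a>> = 1)%VS by apply: memv_adjoin.
  by apply/eqP; rewrite eq_sym eqEdim subv_adjoin e dimv1.
have /eqP -> // : (F == <<1; a>> :> {vspace L})%VS.
by rewrite eq_sym eqEdim sF e leqnn.
Qed.

Lemma generates_scale F a (k : K) : k != 0 -> generates F a ->
  generates F (k%:A * a).
Proof.
move=> k0 [aF g]; split=> [|G]; first by rewrite rpredM ?alg_mem.
move=> kG; apply: g; have -> : a = k^-1%:A * (k%:A * a).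
  by rewrite !mulr_algl scalerA mulVf // scale1r.
by rewrite rpredM ?alg_mem.
Qed.

Lemma generates_eq0 F a : generates F a -> (1 < \dim F)%N -> a != 0.
Proof.
by move=> ga dF; apply: contraNneq (generates_notin ga dF) => ->; apply: mem0v.
Qed.

Local Notation "''Gal' ( V / U )" := (galoisG V U) : ring_scope.
Local Notation N F := (galNorm 1 F).

Lemma card_gal1 F : #|'Gal(F / 1)| = \dim F.
Proof. by rewrite -galois_dim ?galois_sub // dimv1 divn1. Qed.

Definition norm_poly F (P D : L) : {poly L} :=
  \prod_(s in 'Gal(F / 1)) ((s P)%:P + (s D) *: 'X).

Lemma norm_polyP F (P D : L) : P \in F -> D \in F ->
  exists n : {poly K}, map_poly (in_alg L) n = norm_poly F P D.
Proof.
move=> PF DF; suff /polyOver1P[n] : norm_poly F P D \is a polyOver 1%VS.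
  by move=> ->; exists n.
have FF : norm_poly F P D \is a polyOver F.
  apply: rpred_prod => s _; rewrite rpredD ?polyOverC ?memv_gal //.
  by rewrite polyOverZ ?polyOverX ?memv_gal.
apply/polyOverP => i.
rewrite -(galois_fixedField (galois_sub L_abelian F)).
apply/fixedFieldP; first exact: (polyOverP FF).
move=> t tG; rewrite -[LHS]coef_map; congr (polyseq _)`_i.
rewrite /norm_poly rmorph_prod [RHS](reindex_inj (mulIg t)) /=.
apply: eq_big => [s|s sG]; first by rewrite groupMr.
rewrite rmorphD /= map_polyC map_polyZ map_polyX /=.
by rewrite !galM.
Qed.

Lemma size_norm_poly F P D : (size (norm_poly F P D) <= (\dim F).+1)%N.
Proof.
apply: leq_trans (size_prod_leq _ _) _.
rewrite leq_subLR; apply: leq_trans (_ : _ <= (\sum_(s in 'Gal(F / 1)) 2).+1)%N _.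
  rewrite ltnS; apply: leq_sum => s _.
  apply: leq_trans (size_polyD _ _) _; rewrite geq_max.
  rewrite (leq_trans (size_polyC_leq1 _)) //.
  by rewrite (leq_trans (size_scale_leq _ _)) // size_polyX.
by rewrite sum_nat_const -card_gal1 muln2 -addnn addnS.
Qed.

Lemma norm_poly_eval F P D (x : K) :
  (norm_poly F P D).[x%:A] = N F (P + x%:A * D).
Proof.
rewrite horner_prod; apply: eq_bigr => s _.
by rewrite !hornerE rmorphD /= !mulr_algl linearZ /= mulr_algr.
Qed.

Lemma norm_poly_root F P D a : P + a * D = 0 -> (norm_poly F P D).[a] = 0.
Proof.
move=> e; rewrite horner_prod (bigD1 1%g) ?group1 //= !gal_id !hornerE.
by rewrite (mulrC D) e mul0r.
Qed.

Lemma norm_in F a : a \in F -> exists k : K, N F a = k%:A.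
Proof.
by move=> aF; apply/mem1P/mem_galNorm => //; apply: galois_sub.
Qed.

Lemma norm_scale F a (k : K) : N F (k%:A * a) = (k ^+ \dim F)%:A * N F a.
Proof.
rewrite galNormM; congr (_ * _); rewrite /galNorm.
under eq_bigr => s _ do rewrite linearZ /= rmorph1.
by rewrite prodr_const card_gal1 -in_algE rmorphXn.
Qed.

(** Start from generators of norms n and m. Scaling them by m^a n^b and m^c n^d multiplies the norms
    by the powers of these scalars with exponents the two degrees, and the Bezout relations in the
    hypotheses make the results equal. *)
Lemma generates_norm F F' (a b c d : nat) : (1 < \dim F)%N -> (1 < \dim F')%N ->
  (a * \dim F = c * \dim F' + 1)%N -> (d * \dim F' = b * \dim F + 1)%N ->
  exists u v (n : K), [/\ generates F u, generates F' v, n != 0,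
    N F u = n%:A & N F' v = n%:A].
Proof.
move=> d1 d1' e1 e2; have [u0 gu] := generates_ex F; have [v0 gv] := generates_ex F'.
have [n nE] := norm_in gu.1; have [m mE] := norm_in gv.1.
have n0 : n != 0.
  by rewrite -(fmorph_eq0 (in_alg L)) /= -nE galNorm_eq0 (generates_eq0 gu).
have m0 : m != 0.
  by rewrite -(fmorph_eq0 (in_alg L)) /= -mE galNorm_eq0 (generates_eq0 gv).
exists ((m ^+ a * n ^+ b)%:A * u0), ((m ^+ c * n ^+ d)%:A * v0),
  (m ^+ (a * \dim F) * n ^+ (b * \dim F + 1)).
split; try by [apply: generates_scale; rewrite // mulf_neq0 ?expf_neq0
              | rewrite mulf_neq0 ?expf_neq0].
  rewrite norm_scale nE -!in_algE -rmorphM; congr (in_alg L _).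
  by rewrite exprMn -!exprM exprD expr1 mulrA.
rewrite norm_scale mE -!in_algE -rmorphM; congr (in_alg L _).
by rewrite exprMn -!exprM e1 e2 [m ^+ (_ + 1)]exprD expr1 mulrAC.
Qed.

End Gen.

(** * Degrees 12, 15 and 30 *)

Lemma poly_two_roots (K : fieldType) (n : nat) (p : {poly K}) (x0 x1 : K) :
  x0 != x1 -> (size p <= n.+2)%N -> p.[x0] = 0 -> p.[x1] = 0 ->
  exists2 q : {poly K}, p = ('X - x0%:P) * ('X - x1%:P) * q & (size q <= n)%N.
Proof.
move=> nx sp p0 p1; have /factor_theorem[q1 e1] : root p x0 by apply/rootP.
have /factor_theorem[q e2] : root q1 x1.
  move: p1; rewrite e1 hornerM !hornerE => /eqP; rewrite mulf_eq0 subr_eq0.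
  by rewrite [x1 == x0]eq_sym (negPf nx) orbF.
exists q; first by rewrite e1 e2 -mulrA mulrC [('X - x1%:P) * _]mulrC.
have [->|q0] := eqVneq q 0; first by rewrite size_poly0.
move: sp; rewrite e1 e2 !size_Mmonic ?monicXsubC ?mulf_neq0 ?polyXsubC_eq0 //.
by rewrite !size_XsubC !addn2 /=.
Qed.

Section SmallPoly.
Variables (K M : fieldType) (f : {rmorphism K -> M}).

Lemma horner_map3 (p : {poly K}) x : (size p <= 3)%N ->
  (map_poly f p).[x] = f p`_2 * x ^+ 2 + f p`_1 * x + f p`_0.
Proof.
move=> sp; rewrite (@horner_coef_wide _ 3) ?size_map_poly //.
by rewrite !big_ord_recl big_ord0 /= !coef_map /=; ring.
Qed.

Lemma horner_map4 (p : {poly K}) x : (size p <= 4)%N ->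
  (map_poly f p).[x] = f p`_3 * x ^+ 3 + f p`_2 * x ^+ 2 + f p`_1 * x + f p`_0.
Proof.
move=> sp; rewrite (@horner_coef_wide _ 4) ?size_map_poly //.
by rewrite !big_ord_recl big_ord0 /= !coef_map /=; ring.
Qed.
End SmallPoly.

Section Shear.
Variables (R : comNzRingType).

(* The cubic e (1 + lam x) z^2 + (r2 x^2 + r1 x + r0) z + (f3 x^3 + ... + f0) = 0
   in the coordinates X = x / (1 + lam x) and z / (1 + lam x). *)
Definition shear (lam e r2 r1 r0 f3 f2 f1 f0 : R) := ZCubic e
  (r2 - lam * r1 + lam ^+ 2 * r0) (r1 - 2 * lam * r0) r0
  (f3 - lam * f2 + lam ^+ 2 * f1 - lam ^+ 3 * f0)
  (f2 - 2 * lam * f1 + 3 * lam ^+ 2 * f0) (f1 - 3 * lam * f0) f0.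

End Shear.

Lemma shear_map (R S : comNzRingType) (f : {rmorphism R -> S})
    lam e r2 r1 r0 f3 f2 f1 f0 :
  zmap f (shear lam e r2 r1 r0 f3 f2 f1 f0)
    = shear (f lam) (f e) (f r2) (f r1) (f r0) (f f3) (f f2) (f f1) (f f0).
Proof. by rewrite /zmap /shear /=; congr ZCubic; ring. Qed.

Lemma shear_on (M : fieldType) (lam e r2 r1 r0 f3 f2 f1 f0 x z : M) :
  1 + lam * x != 0 ->
  e * (1 + lam * x) * z ^+ 2 + (r2 * x ^+ 2 + r1 * x + r0) * z
    + (f3 * x ^+ 3 + f2 * x ^+ 2 + f1 * x + f0) = 0 ->
  zval (shear lam e r2 r1 r0 f3 f2 f1 f0) (x / (1 + lam * x)) (z / (1 + lam * x)) = 0.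
Proof.
move=> n e0; apply: (mulIf (expf_neq0 3 n)); rewrite mul0r -[RHS]e0.
by rewrite /zval /=; field.
Qed.

Section Degree12.
Variables (K : fieldType) (L : splittingFieldType K).
Hypothesis L_abelian : abelian_extension L.
Hypothesis K_infinite : infinite_set [set: K]%classic.
Implicit Types (F G : {subfield L}) (a u : L).

Definition infinitely_many_new :=
  exists S : set (elliptic_curve K),
    [/\ infinite_set S, set_inj S (@j_invariant K) &
        forall E : elliptic_curve K, S E -> has_new_point L E].

Lemma prod_dim F1 F2 : coprime (\dim F1) (\dim F2) ->
  \dim (F1 * F2)%AS = (\dim F1 * \dim F2)%N.
Proof.
move=> co; apply/eqP; rewrite eqn_leq dim_prodv dvdn_leq ?adim_gt0 //.
by rewrite Gauss_dvd // !field_dimS ?field_subvMl ?field_subvMr.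
Qed.

Lemma prod_full F1 F2 : coprime (\dim F1) (\dim F2) ->
  (\dim F1 * \dim F2)%N = \dim {:L} -> (F1 * F2)%AS = {:L}%AS.
Proof.
by move=> co e; apply/val_inj/eqP; rewrite /= eqEdim subvf -e -prod_dim /=.
Qed.

Lemma infinite_neq0 : infinite_set [set t : K | t != 0]%classic.
Proof.
move=> fin; apply: K_infinite.
have : finite_set ([set t : K | t != 0] `|` [set 0])%classic.
  by rewrite finite_setU; split.
apply: sub_finite_set => t _; have [->|n] := eqVneq t 0; [by right | by left].
Qed.

(* Norm form of 1 - X + uX: it interpolates between 1 at X = 0 and the norm of
   u at X = 1. *)
Lemma norm_form F u (n : K) : generates F u -> (1 < \dim F)%N ->
  galNorm 1 F u = n%:A ->
  exists (f : {poly K}) (xi : L), [/\ (size f <= (\dim F).+1)%N, f.[0] = 1, f.[1] = n,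
    (map_poly (in_alg L) f).[xi] = 0 & generates F xi].
Proof.
move=> gu d1 nE; have uF := gu.1; have u1 := generates_notin gu d1.
have [f fE] : exists f, map_poly (in_alg L) f = norm_poly F 1 (u - 1).
  by apply: norm_polyP; rewrite ?rpredB ?mem1v.
have evE (x : K) : in_alg L f.[x] = galNorm 1 F (1 + x%:A * (u - 1)).
  by rewrite -norm_poly_eval -fE -horner_map.
have un : 1 - u != 0.
  by rewrite subr_eq0; apply: contraNneq u1 => <-; apply: mem1v.
exists f, (1 - u)^-1; split.
- by rewrite -(size_map_poly (in_alg L)) fE size_norm_poly.
- apply: (fmorph_inj (in_alg L)); apply: etrans (evE 0) _.
  by rewrite scale0r mul0r addr0 galNorm1 /= scale1r.
- apply: (fmorph_inj (in_alg L)); apply: etrans (evE 1) _.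
  by rewrite scale1r mul1r addrC subrK.
- by rewrite fE norm_poly_root // -[u - 1]opprB mulrN mulVf // subrr.
split; first by rewrite rpredV rpredB ?mem1v.
move=> G; rewrite rpredV => uG; apply: gu.2.
by rewrite -[u](subKr 1) rpredB ?mem1v.
Qed.

Lemma case_3_4 F3 F4 : \dim F3 = 3%N -> \dim F4 = 4%N -> \dim {:L} = 12%N ->
  infinitely_many_new.
Proof.
move=> d3 d4 dL.
have [u [v [n [gu gv n0 Nu Nv]]]] : exists u v (n : K), [/\ generates F3 u,
    generates F4 v, n != 0, galNorm 1 F3 u = n%:A & galNorm 1 F4 v = n%:A].
  by apply: (@generates_norm K L L_abelian F3 F4 3 1 2 1); rewrite ?d3 ?d4.
have d31 : (1 < \dim F3)%N by rewrite d3.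
have d41 : (1 < \dim F4)%N by rewrite d4.
have [f [xi [sf f0 f1 fxi gxi]]] := norm_form gu d31 Nu.
have [g [xi' [sg g0 g1 gxi' gxi'F]]] := norm_form gv d41 Nv.
rewrite d3 in sf; rewrite d4 in sg.
have [q fgE sq] : exists2 q, f - g = ('X - 0%:P) * ('X - 1%:P) * q & (size q <= 3)%N.
  apply: poly_two_roots; rewrite ?hornerD ?hornerN ?f0 ?g0 ?f1 ?g1 ?subrr //.
    by rewrite eq_sym oner_neq0.
  by rewrite (leq_trans (size_polyD _ _)) // geq_max size_polyN sg (leq_trans sf).
pose c : zcubic {poly K} := ZCubic 'X (q`_2 *: 'X - 1) (q`_1 *: 'X + 1) (q`_0 *: 'X)
  (- f`_3)%:P (- f`_2)%:P (- f`_1)%:P (- f`_0)%:P.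
have fE x : f.[x] = f`_3 * x ^+ 3 + f`_2 * x ^+ 2 + f`_1 * x + f`_0.
  by rewrite -(horner_map4 idfun x sf) map_poly_id.
have zE t (X z : L) : zval (zmap (in_alg L) (zmap (horner_eval t) c)) X z
    = in_alg L t * z ^+ 2 + (in_alg L t * (map_poly (in_alg L) q).[X] - X * (X - 1)) * z
      - (map_poly (in_alg L) f).[X].
  rewrite (horner_map3 _ _ sq) (horner_map4 _ _ sf) /zval /= /horner_eval.
  rewrite !(hornerX, hornerZ, hornerD, hornerN, hornerC) -!in_algE; ring.
apply: (infinite_two_nodes infinite_neq0 (c := c)).
  split=> //=; rewrite ?(hornerX, hornerZ, hornerD, hornerN, hornerC).
  - by split; ring.
  - by rewrite oppr_eq0 -horner_coef0 f0 oner_neq0.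
  - apply: contraNneq n0 => e; apply/eqP; rewrite -f1 fE; apply: oppr_inj; rewrite oppr0 -[RHS]e; ring.
move=> t /= t0 d.
have tL : in_alg L t != 0 by rewrite fmorph_eq0.
have on3 : zval (zmap (in_alg L) (zmap (horner_eval t) c)) xi 0 = 0.
  by rewrite zE fxi; ring.
have p3 := zpoint d on3 gxi.1 (mem0v _) (fun G xG _ => gxi.2 G xG).
have on4 : zval (zmap (in_alg L) (zmap (horner_eval t) c))
    xi' (xi' * (xi' - 1) / in_alg L t) = 0.
  rewrite zE; transitivity (- (map_poly (in_alg L) g).[xi']); last by rewrite gxi' oppr0.
  have -> : g = f - ('X - 0%:P) * ('X - 1%:P) * q by rewrite -fgE subKr.
  rewrite subr0 !(rmorphB, rmorphM) /= map_polyX map_polyC.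
  rewrite !(hornerD, hornerN, hornerM, hornerX, hornerC) -?in_algE; field; exact: tL.
have z4 : xi' * (xi' - 1) / in_alg L t \in F4.
  by have := gxi'F.1 => xF; have tF := alg_mem F4 t; solve_mem.
have p4 := zpoint d on4 gxi'F.1 z4 (fun G xG _ => gxi'F.2 G xG).
have [|||P pf] := point_field_chord L_abelian _ _ _ p3 p4; rewrite ?d3 ?d4 //.
move: pf; rewrite prod_full ?d3 ?d4 ?dL //; exact: point_field_new.
Qed.

(** Now g - f = X (X - 1) S with S possibly cubic, of leading coefficient l. The term l t^2 x z^2
    absorbs l at the cost of adding l to the coefficient [q2], and [shear] removes this term. The
    points are z = 0 above a root of f and z = x (x - 1) / t above a root of g. The fibre above x =
    0 is z^2 + S(0) z + 1/t = 0; it is left available for a quadratic point in degree 30. *)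
Lemma family_3_5 F3 F5 : \dim F3 = 3%N -> \dim F5 = 5%N ->
  exists (c : zcubic {poly K}) (s : K), two_nodes c /\
    forall t : K, t != 0 -> forall d : disc (zw (zmap (horner_eval t) c)) != 0,
    [/\ exists P, point_field (zcurve d) F3 P, exists P, point_field (zcurve d) F5 P
      & forall F2 (z : L), \dim F2 = 2%N -> z \in F2 -> z \notin 1%VS ->
        z ^+ 2 + s%:A * z + t^-1%:A = 0 -> exists P, point_field (zcurve d) F2 P].
Proof.
move=> d3 d5.
have d31 : (1 < \dim F3)%N by rewrite d3.
have d51 : (1 < \dim F5)%N by rewrite d5.
have [u [v [n [gu gv n0 Nu Nv]]]] : exists u v (n : K), [/\ generates F3 u,
    generates F5 v, n != 0, galNorm 1 F3 u = n%:A & galNorm 1 F5 v = n%:A].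
  by apply: (@generates_norm K L L_abelian F3 F5 2 3 1 2); rewrite ?d3 ?d5.
have [f [xi [sf f0 f1 fxi gxi]]] := norm_form gu d31 Nu.
have [g [xi' [sg g0 g1 gxi' gxi'F]]] := norm_form gv d51 Nv.
rewrite d3 in sf; rewrite d5 in sg.
have [S fgE sS] : exists2 S, g - f = ('X - 0%:P) * ('X - 1%:P) * S & (size S <= 4)%N.
  apply: poly_two_roots; rewrite ?hornerD ?hornerN ?f0 ?g0 ?f1 ?g1 ?subrr //.
    by rewrite eq_sym oner_neq0.
  by rewrite (leq_trans (size_polyD _ _)) // geq_max size_polyN sg (leq_trans sf).
pose l := S`_3; pose q2 := S`_2 + l; pose q1 := S`_1; pose q0 := S`_0.
pose c : zcubic {poly K} := shear (l *: 'X) 'X (q2 *: 'X - 1) (q1 *: 'X + 1) (q0 *: 'X)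
  (f`_3)%:P (f`_2)%:P (f`_1)%:P (f`_0)%:P.
have fE x : f.[x] = f`_3 * x ^+ 3 + f`_2 * x ^+ 2 + f`_1 * x + f`_0.
  by rewrite -(horner_map4 idfun x sf) map_poly_id.
have f00 : f`_0 = 1 by rewrite -horner_coef0.
exists c, q0; split.
  rewrite /two_nodes /c /shear /=.
  rewrite !(hornerX, hornerZ, hornerD, hornerN, hornerC, hornerM, horner_exp, hornerMn).
  split=> //; first by split; ring.
  - by rewrite f00 oner_neq0.
  - apply: contraNneq n0 => e; apply/eqP; rewrite -f1 fE -[RHS]e f00; ring.
move=> t t0 d; have tL : in_alg L t != 0 by rewrite fmorph_eq0.
have on x z : 1 + in_alg L (l * t) * x != 0 ->
  in_alg L t * (1 + in_alg L (l * t) * x) * z ^+ 2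
    + (in_alg L (q2 * t - 1) * x ^+ 2 + in_alg L (q1 * t + 1) * x + in_alg L (q0 * t)) * z
    + (map_poly (in_alg L) f).[x] = 0 ->
  zval (zmap (in_alg L) (zmap (horner_eval t) c))
    (x / (1 + in_alg L (l * t) * x)) (z / (1 + in_alg L (l * t) * x)) = 0.
  move=> nx; rewrite (horner_map4 _ _ sf) !shear_map /= /horner_eval.
  rewrite !(hornerX, hornerZ, hornerD, hornerN, hornerC) => e.
  exact: shear_on.
have mu x : x \notin 1%VS -> 1 + in_alg L (l * t) * x != 0.
  move=> x1; have [->|ln] := eqVneq (l * t) 0.
    by rewrite rmorph0 mul0r addr0 oner_neq0.
  apply: contraNneq x1 => e; have -> : x = - (in_alg L (l * t))^-1.
    apply: (mulfI (_ : in_alg L (l * t) != 0)); first by rewrite fmorph_eq0.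
    by rewrite mulrN mulfV ?fmorph_eq0 //; apply/eqP; rewrite -addr_eq0 addrC e.
  by rewrite rpredN rpredV; apply: (alg_mem 1%AS).
have gen F x z : generates F x -> 1 + in_alg L (l * t) * x != 0 -> z \in F ->
  zval (zmap (in_alg L) (zmap (horner_eval t) c))
    (x / (1 + in_alg L (l * t) * x)) (z / (1 + in_alg L (l * t) * x)) = 0 ->
  exists P, point_field (zcurve d) F P.
  move=> [xF gx] nx zF on'; have aF := alg_mem F (l * t).
  eexists; apply: (zpoint d on'); try solve_mem.
  move=> G XG _; apply: gx.
  have := alg_mem G (l * t); move: XG nx; rewrite -in_algE.
  move: (in_alg L (l * t)) => k; set X := x / _ => XG nx kG.
  have nX : 1 - k * X != 0.
    have -> : 1 - k * X = (1 + k * x)^-1 by rewrite /X; field.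
    by rewrite invr_eq0.
  have -> : x = X / (1 - k * X).
    by apply: (mulIf nX); rewrite divfK // /X; field.
  solve_mem.
split.
- apply: (gen F3 xi 0) => //; first by apply: mu (generates_notin gxi d31).
    exact: mem0v.
  by apply: on; [apply: mu (generates_notin gxi d31) | rewrite fxi; ring].
- have n5 := mu _ (generates_notin gxi'F d51).
  apply: (gen F5 xi' (xi' * (xi' - 1) / in_alg L t)) => //.
    by have xF := gxi'F.1; have tF := alg_mem F5 t; solve_mem.
  apply: on => //; transitivity (map_poly (in_alg L) g).[xi']; last exact: gxi'.
  have -> : (map_poly (in_alg L) g).[xi'] = (map_poly (in_alg L) f).[xi']
      + xi' * (xi' - 1) * (map_poly (in_alg L) S).[xi'].
    have -> : g = f + ('X - 0%:P) * ('X - 1%:P) * S by rewrite -fgE addrC subrK.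
    rewrite !(rmorphD, rmorphM, rmorphN) /= map_polyX !map_polyC.
    rewrite !(hornerD, hornerM, hornerN, hornerX, hornerC) -?in_algE; ring.
  by rewrite (horner_map4 _ _ sS) /q2 /q1 /q0 /l; field; exact: tL.
move=> F2 z d2 zF z1 ez.
have on2 : zval (zmap (in_alg L) (zmap (horner_eval t) c)) 0 z = 0.
  rewrite !shear_map /= /horner_eval.
  rewrite !(hornerX, hornerZ, hornerD, hornerN, hornerC) /zval /= f00.
  rewrite -!in_algE; apply: (mulIf (_ : (in_alg L t)^-1 != 0)).
    by rewrite invr_eq0.
  by rewrite mul0r -[RHS]ez -!in_algE; field.
eexists; apply: (zpoint d on2) => //; first exact: mem0v.
move=> G _; apply: (generates_prime _ zF z1).2; by rewrite d2.
Qed.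

End Degree12.

Section Degree30.
Variables (K : fieldType) (L : splittingFieldType K).
Hypothesis L_abelian : abelian_extension L.
Hypothesis K_infinite : infinite_set [set: K]%classic.
Implicit Types (F G U : {subfield L}) (a u : L).
Local Notation "''Gal' ( V / U )" := (galoisG V U) : ring_scope.

Lemma quadratic_conj U F : galois U F -> \dim_U F = 2%N ->
  exists2 s, s \in 'Gal(F / U) & forall b, b \in F ->
    [/\ b + s b \in U, b * s b \in U & s b = b -> b \in U].
Proof.
move=> gF dF; have cG : #|'Gal(F / U)| = 2%N by rewrite -galois_dim.
have : #|('Gal(F / U) :\ 1)%g| == 1%N.
  by have := cardsD1 1%g 'Gal(F / U); rewrite cG group1 add1n => -[<-].
case/cards1P=> s /setP sE.
have sP x : (x \in 'Gal(F / U)) && (x != 1%g) = (x == s).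
  by have := sE x; rewrite !inE andbC.
have /andP[sG _] : (s \in 'Gal(F / U)) && (s != 1%g) by rewrite sP.
exists s => // b bF; split.
- have := mem_galTrace gF bF; rewrite /galTrace (bigD1 1%g) ?group1 //= gal_id.
  by rewrite (big_pred1 s).
- have := mem_galNorm gF bF; rewrite /galNorm (bigD1 1%g) ?group1 //= gal_id.
  by rewrite (big_pred1 s).
move=> sb; rewrite -(galois_fixedField gF); apply/fixedFieldP => // x xG.
have [->|x1] := eqVneq x 1%g; first by rewrite gal_id.
by have := sP x; rewrite xG x1 => /esym/eqP->.
Qed.

Lemma quadratic_gen F : \dim F = 2%N -> exists b (T N : K),
  [/\ b \in F, b \notin 1%VS, b ^+ 2 = T%:A * b - N%:A & T ^+ 2 != 4 * N].
Proof.
move=> dF; have gF := galois_sub L_abelian F.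
have [|s sG sP] := quadratic_conj gF; first by rewrite dimv1 divn1.
have [b gb] := generates_ex L_abelian F.
have bF := gb.1; have b1 : b \notin 1%VS by apply: (generates_notin gb); rewrite dF.
have [/mem1P[T eT] /mem1P[N eN] sb] := sP b bF.
exists b, T, N; split=> //; first by rewrite -eT -eN; ring.
apply: contraNneq b1 => e; apply: sb.
have : (b - s b) ^+ 2 = 0.
  transitivity ((b + s b) ^+ 2 - 4 * (b * s b)); first by ring.
  rewrite eT eN -!in_algE -rmorphXn e rmorphM rmorph_nat; ring.
by move/eqP; rewrite expf_eq0 /= subr_eq0 => /eqP.
Qed.

Lemma quadratic_dependent (p q r s : K) (b : L) : b \notin 1%VS ->
  p%:A * b + q%:A = r%:A * b + s%:A -> p = r /\ q = s.
Proof.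
move=> b1 e.
have pr : p = r.
  apply/eqP; rewrite -subr_eq0; apply: contraNT b1 => n.
  have nL : in_alg L (p - r) != 0 by rewrite fmorph_eq0.
  have -> : b = in_alg L ((s - q) / (p - r)).
    apply: (mulfI nL); rewrite -rmorphM mulrC [(p - r) * _]mulrC divfK //.
    apply/eqP; rewrite -subr_eq0; apply/eqP.
    transitivity ((p%:A * b + q%:A) - (r%:A * b + s%:A)).
      by rewrite -!in_algE; ring.
    by rewrite e subrr.
  exact: (alg_mem 1%AS).
split=> //; move: e; rewrite pr => /addrI/eqP.
by rewrite -!in_algE (inj_eq (fmorph_inj _)) => /eqP.
Qed.

Lemma case_3_5 F3 F5 : \dim F3 = 3%N -> \dim F5 = 5%N -> \dim {:L} = 15%N ->
  infinitely_many_new L.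
Proof.
move=> d3 d5 dL; have [c [s [cn new]]] := family_3_5 L_abelian d3 d5.
apply: (infinite_two_nodes (infinite_neq0 K_infinite) cn) => t t0 d.
have [[P3 p3] [P5 p5] _] := new t t0 d.
have [|||P pf] := point_field_chord L_abelian _ _ _ p3 p5; rewrite ?d3 ?d5 //.
move: pf; rewrite prod_full ?d3 ?d5 ?dL //; exact: point_field_new.
Qed.

(** The coefficient s of z^2 + s z + 1/t is imposed by F3 and F5, so only t can be adapted to F2.
    Completing squares with s = 2 h and T = 2 g, the element b - g has square g^2 - N in K, and z =
    y (b - g) - h is a root when 1/t = h^2 - (g^2 - N) y^2. *)
Lemma case_2_3_5 F2 F3 F5 : 2%N \notin [pchar K] ->
  \dim F2 = 2%N -> \dim F3 = 3%N -> \dim F5 = 5%N -> \dim {:L} = 30%N ->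
  infinitely_many_new L.
Proof.
move=> char2 d2 d3 d5 dL.
have n2 : 2 != 0 :> K by apply: contra char2; rewrite inE.
have [c [s [cn new]]] := family_3_5 L_abelian d3 d5.
have [b [T [N [bF b1 bE TN]]]] := quadratic_gen d2.
have [h sE] : exists h, s = 2 * h by exists (s / 2); field.
have [g TE] : exists g, T = 2 * g by exists (T / 2); field.
pose mu (y : K) := h ^+ 2 - (g ^+ 2 - N) * y ^+ 2.
pose z (y : K) := in_alg L y * (b - in_alg L g) - in_alg L h.
have zP y : z y ^+ 2 + s%:A * z y + (mu y)%:A = 0.
  rewrite /z /mu sE -!in_algE.
  transitivity (in_alg L y ^+ 2 * (b ^+ 2 - (in_alg L T * b - in_alg L N))); last first.
    by rewrite bE subrr mulr0.
  by rewrite TE; ring.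
have z1 y : y != 0 -> z y \notin 1%VS.
  move=> y0; apply: contra b1 => z1; have yL : in_alg L y != 0 by rewrite fmorph_eq0.
  have -> : b = (z y + in_alg L h) / in_alg L y + in_alg L g.
    by rewrite /z subrK mulrAC mulfV // mul1r subrK.
  have m (k : K) : in_alg L k \in (1%AS : {subfield L}) by apply: alg_mem.
  have [[ms my] mT] := (m h, m y, m g).
  have : z y \in (1%AS : {subfield L}) by [].
  rewrite -[_ \in 1%VS]/(_ \in (1%AS : {subfield L})) => ?; solve_mem.
have mu0 y : y != 0 -> mu y != 0.
  move=> y0; apply: contraNneq (z1 y y0) => e; move: (zP y); rewrite e scale0r addr0.
  rewrite expr2 -mulrDl => /eqP; rewrite mulf_eq0 addr_eq0 => /orP[]/eqP->.
    by rewrite rpredN; apply: (alg_mem 1%AS).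
  exact: mem0v.
have infT : infinite_set ((fun y => (mu y)^-1) @` [set y : K | y != 0])%classic.
  apply: infinite_fibers; first exact: infinite_neq0.
  move=> y; have : finite_set [set t : K | ((h ^+ 2 - y^-1)%:P
     - (g ^+ 2 - N)%:P * 'X^2).[idfun t] = 0]%classic.
    apply: (@finite_roots K K idfun); apply/eqP => /(congr1 (fun p : {poly K} => p`_2)).
    rewrite coefB coefC coefCM coefXn coef0 /= mulr1 sub0r => /eqP.
    rewrite oppr_eq0 subr_eq0 => /eqP e; case/negP: TN; rewrite TE -e.
    by apply/eqP; ring.
  apply: sub_finite_set => t [/= t0 <-]; rewrite invrK /mu.
  by rewrite !(hornerD, hornerN, hornerC, hornerM, hornerXn, hornerX); ring.
apply: (infinite_two_nodes infT cn) => t [y /= y0 <-] d.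
have [[P3 p3] [P5 p5] p2] := new _ (invr_neq0 (mu0 y y0)) d.
have [|||P pf] := point_field_chord L_abelian _ _ _ p3 p5; rewrite ?d3 ?d5 //.
have zF : z y \in F2.
  have := alg_mem F2 y; have := alg_mem F2 g; have := alg_mem F2 h.
  by rewrite -!in_algE /z => *; solve_mem.
have [|P2 q2] := p2 F2 (z y) d2 zF (z1 y y0); first by rewrite invrK; apply: zP.
have d15 : \dim (F3 * F5)%AS = 15%N by rewrite prod_dim d3 d5.
have [|||Q qf] := point_field_chord L_abelian _ _ _ q2 pf; rewrite ?d15 ?d2 //.
move: qf; rewrite prod_full ?d15 ?d2 ?dL //; exact: point_field_new.
Qed.

End Degree30.

(** * Degree 14 *)

Lemma generates_indep (K : fieldType) (L : splittingFieldType K) (F : {subfield L})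
    (a : L) (p : {poly K}) : generates F a -> p != 0 -> (size p <= \dim F)%N ->
  (map_poly (in_alg L) p).[a] != 0.
Proof.
move=> [aF ga] p0 sp; apply: contra p0 => /eqP pa.
rewrite -(map_poly_eq0 (in_alg L)) -(@root_small_adjoin_poly _ _ 1%AS a).
- by apply/rootP.
- by apply/polyOver1P; exists p.
rewrite size_map_poly (leq_trans sp) // /adjoin_degree dimv1 divn1.
have : (F <= <<1; a>>)%VS by apply: (ga <<1; a>>%AS); apply: memv_adjoin.
move/dimvS => le; rewrite prednK ?adim_gt0 //.
Qed.

Lemma generates_quartic (K : fieldType) (L : splittingFieldType K) (F : {subfield L})
    (a : L) (c3 c2 c1 c0 : K) : generates F a -> (4 < \dim F)%N ->
  a ^+ 4 + in_alg L c3 * a ^+ 3 + in_alg L c2 * a ^+ 2 + in_alg L c1 * a + in_alg L c0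
    != 0.
Proof.
move=> ga d4; pose q := Poly [:: c0; c1; c2; c3].
have sP : (size q <= 4)%N by apply: size_Poly.
have qE i : q`_i = [:: c0; c1; c2; c3]`_i by rewrite coef_Poly.
pose p := 'X^4 + q; clearbody q.
have sp : size p = 5 by rewrite /p size_polyDl size_polyXn // ltnS.
have := @generates_indep _ _ F a p ga; rewrite -size_poly_eq0 sp => /(_ isT d4).
rewrite rmorphD /= map_polyXn hornerD hornerXn (@horner_coef_wide _ 4) ?size_map_poly //.
rewrite !big_ord_recl big_ord0 !coef_map !qE /= -!in_algE => n.
by apply: contra n => /eqP e; apply/eqP; rewrite -[RHS]e; ring.
Qed.

Section Degree14.
Variables (K : fieldType) (L : splittingFieldType K).
Hypothesis L_abelian : abelian_extension L.
Hypothesis K_infinite : infinite_set [set: K]%classic.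
Implicit Types (F G : {subfield L}).
Local Notation N F := (galNorm 1 F).

(** The quotient v of b + y by its conjugate has norm 1, and k = [kap y] is minus its trace. Each k
    comes from finitely many y. *)
Lemma infinite_norm_one F2 : \dim F2 = 2%N ->
  infinite_set [set k : K | exists v : L,
    [/\ v \in F2, v \notin 1%VS & v ^+ 2 + in_alg L k * v + 1 = 0]]%classic.
Proof.
move=> d2 fin; have [b [T [n [bF b1 bE Tn]]]] := quadratic_gen L_abelian d2.
rewrite -!in_algE in bE.
pose nm (y : K) := y ^+ 2 + T * y + n.
pose kap (y : K) := 2 - (T + 2 * y) ^+ 2 / nm y.
have nmE y : in_alg L (nm y) = (b + in_alg L y) * (in_alg L T - b + in_alg L y).
  apply/eqP; rewrite -subr_eq0; apply/eqP.
  transitivity (b ^+ 2 - (in_alg L T * b - in_alg L n)); first by rewrite /nm; ring.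
  by rewrite bE subrr.
have notin1 (p q : K) : p != 0 -> in_alg L p * b + in_alg L q != 0.
  move=> p0; apply: contraNneq p0 => e; apply/eqP.
  have := @quadratic_dependent K L p q 0 0 b b1; rewrite -!in_algE e => h.
  by have [] := h; [ring|].
have b0 y : b + in_alg L y != 0.
  by have := notin1 1 y (oner_neq0 _); rewrite rmorph1 mul1r.
have b'0 y : in_alg L T - b + in_alg L y != 0.
  have := notin1 (-1) (T + y); rewrite oppr_eq0 oner_neq0 => /(_ isT).
  by apply: contra => /eqP e; apply/eqP; rewrite -[RHS]e; ring.
have nmL y : in_alg L (nm y) != 0 by rewrite nmE mulf_neq0.
have nm0 y : nm y != 0 by have := nmL y; rewrite fmorph_eq0.
have : infinite_set (kap @` [set: K])%classic.
  apply: infinite_fibers => // k.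
  have : finite_set [set t : K | ((4 - (2 - k))%:P * 'X^2 + ((4 - (2 - k)) * T)%:P * 'X
     + (T ^+ 2 - (2 - k) * n)%:P).[idfun t] = 0]%classic.
    apply: (@finite_roots K K idfun); apply/eqP => p0.
    have := congr1 (fun p : {poly K} => p`_2) p0; have := congr1 (fun p : {poly K} => p`_0) p0.
    rewrite !coefD !coefCM !coefXn !coefX !coefC /= => e0 e2.
    (* The leading coefficient vanishes only for k = -2, and then the constant one is T^2 - 4 n. *)
    case/eqP: Tn; apply/eqP; rewrite -subr_eq0 -[X in _ == X]e0.
    apply/eqP; transitivity (T ^+ 2 - (4 - (4 - (2 - k))) * n); last by ring.
    have -> : 4 - (2 - k) = 0 by rewrite -[RHS]e2; ring.
    ring.
  apply: sub_finite_set => y [_ <-] /=; rewrite /kap.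
  rewrite !(hornerD, hornerC, hornerM, hornerXn, hornerX) /=.
  apply: (mulIf (nm0 y)); rewrite mul0r.
  by rewrite /nm; have := nm0 y; rewrite /nm => h; field.
apply; apply: (@sub_finite_set _ _ ([set 2] `|` [set k : K | exists v : L,
    [/\ v \in F2, v \notin 1%VS & v ^+ 2 + in_alg L k * v + 1 = 0]])%classic); last first.
  by rewrite finite_setU; split.
(* When T + 2 y = 0 the quotient is -1, which is rational; this is the exceptional value k = 2. *)
move=> _ [y _ <-]; have [Ty|Ty] := eqVneq (T + 2 * y) 0.
  by left; rewrite /= /kap Ty expr0n /= mul0r subr0.
right; exists ((b + in_alg L y) / (in_alg L T - b + in_alg L y)); split.
- by have := alg_mem F2 T; have := alg_mem F2 y; rewrite -!in_algE => ? ?; solve_mem.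
- apply/negP => /mem1P[k]; rewrite -in_algE => kE.
  have e : b + in_alg L y = in_alg L k * (in_alg L T - b + in_alg L y).
    by rewrite -kE divfK.
  have e' : in_alg L (1 + k) * b + in_alg L (y - k * (T + y)) = 0.
    by rewrite -[RHS](subrr (b + in_alg L y)) {2}e; ring.
  have [k0|k0] := eqVneq (1 + k) 0; last by move: (notin1 _ (y - k * (T + y)) k0); rewrite e' eqxx.
  case/eqP: Ty; apply: (fmorph_inj (in_alg L)); rewrite rmorph0 -[RHS]e'.
  have -> : k = -1 by apply/eqP; rewrite -addr_eq0 addrC k0.
  ring.
have -> : in_alg L (kap y) = 2 - (in_alg L T + 2 * in_alg L y) ^+ 2 / in_alg L (nm y).
  by rewrite /kap rmorphB rmorph_nat rmorphM fmorphV; congr (2 - _ / _); ring.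
rewrite nmE; have := b0 y; have := b'0 y.
move: (in_alg L T) (in_alg L y) => T' y' h h'.
by field; rewrite h h'.
Qed.
Lemma norm_sqr F w : w \in F -> w != 0 ->
  exists2 k : K, k != 0 & N F (w ^+ 2) = in_alg L (k ^+ 2).
Proof.
move=> wF w0; have [k kE] := norm_in L_abelian wF; rewrite -in_algE in kE.
exists k; first by rewrite -(fmorph_eq0 (in_alg L)) -[X in X != 0]kE galNorm_eq0.
by rewrite [RHS]rmorphXn expr2 galNormM kE.
Qed.

(* In odd characteristic P, P + D / 2, P + D is the arithmetic progression of squares
   (m^2 - 2m - 1)^2, (m^2 + 1)^2, (m^2 + 2m - 1)^2; in characteristic 2, all of m^2,
   m^2 + 1, m^2 + c^2 are squares. *)
Lemma square_norms F : (4 < \dim F)%N ->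
  exists (P D : L) (x k0 k1 k2 : K), [/\ [/\ P \in F, D \in F & D != 0],
    - P / D \notin 1%VS, [/\ x != 0, x != 1 & [/\ k0 != 0, k1 != 0 & k2 != 0]]
  & [/\ N F P = in_alg L (k0 ^+ 2), N F (P + D) = in_alg L (k1 ^+ 2)
    & N F (P + in_alg L x * D) = in_alg L (k2 ^+ 2)]].
Proof.
move=> d4; have [m gm] := generates_ex L_abelian F; have mF := gm.1.
have q4 := generates_quartic _ _ _ _ gm d4.
have q2 (p q : K) : m ^+ 2 + in_alg L p * m + in_alg L q != 0.
  apply: contraNneq (q4 p q 0 0) => e; apply/eqP.
  by transitivity (m ^+ 2 * (m ^+ 2 + in_alg L p * m + in_alg L q)); [ring|rewrite e mulr0].
have m0 : m != 0.
  by apply: contraNneq (q2 0 0) => ->; apply/eqP; ring.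
have [c2|c2] := boolP (2%N \in [pchar K]); last first.
  have n2 : 2 != 0 :> K by apply: contra c2; rewrite inE.
  have n2L : 2 != 0 :> L by rewrite -(rmorph_nat (in_alg L)) fmorph_eq0.
  have [a0 a1 a2] : [/\ m ^+ 2 - 2 * m - 1 != 0, m ^+ 2 + 2 * m - 1 != 0
      & m ^+ 2 + 1 != 0].
    split; [apply: contraNneq (q2 (-2) (-1)) | apply: contraNneq (q2 2 (-1))
      | apply: contraNneq (q2 0 1)] => e; apply/eqP; rewrite -[RHS]e; ring.
  have [f0 f1 f2] : [/\ m ^+ 2 - 2 * m - 1 \in F, m ^+ 2 + 2 * m - 1 \in F
      & m ^+ 2 + 1 \in F] by split; solve_mem.
  have [k0 ? e0] := norm_sqr f0 a0.
  have [k1 ? e1] := norm_sqr f1 a1.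
  have [k2 ? e2] := norm_sqr f2 a2.
  pose D := 8 * m * (m ^+ 2 - 1).
  have D0 : D != 0.
    rewrite !mulf_neq0 //.
      by rewrite (_ : 8 = 2 * 2 * 2) ?mulf_neq0 //; ring.
    by apply: contraNneq (q2 0 (-1)) => e; apply/eqP; rewrite -[RHS]e; ring.
  exists ((m ^+ 2 - 2 * m - 1) ^+ 2), D, 2^-1, k0, k1, k2; split.
  - by rewrite /D; split=> //; solve_mem.
  - apply/negP => /mem1P[k]; rewrite -in_algE => kE.
    case/negP: (q4 (-4 + 8 * k) 2 (4 - 8 * k) 1); apply/eqP.
    transitivity ((m ^+ 2 - 2 * m - 1) ^+ 2 + in_alg L k * D).
      by rewrite /D; ring.
    by rewrite -kE divfK // addrN.
  - split=> //; first by rewrite invr_eq0.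
    apply/eqP => h; have := mulfV n2; rewrite h => e; case/eqP: (oner_neq0 K).
    by rewrite -[RHS](subrr 1) -{2}e; ring.
  rewrite e0; split=> //.
    by rewrite /D -e1; congr (galNorm _ _ _); ring.
  rewrite /D fmorphV rmorph_nat -e2; congr (galNorm _ _ _); field; exact: n2L.
have two0 : 2 = 0 :> L by rewrite -(rmorph_nat (in_alg L)) (pcharf0 c2) rmorph0.
have [c c0] : exists c : K, c * (c ^+ 2 - 1) != 0.
  apply: contrapT => no; apply: (K_infinite).
  have : finite_set [set t : K | ('X * ('X^2 - 1%:P)).[idfun t] = 0]%classic.
    apply: (@finite_roots K K idfun); rewrite mulf_neq0 ?polyX_eq0 //.
    by rewrite -size_poly_eq0 size_XnsubC.
  apply: sub_finite_set => t _ /=; apply/eqP/negPn/negP => h; apply: no.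
  by exists t; move: h; rewrite hornerM hornerX hornerD hornerN hornerXn hornerC.
move: c0; rewrite mulf_eq0 subr_eq0 negb_or => /andP[c0 c1].
have sq (y : L) : m ^+ 2 + y ^+ 2 = (m + y) ^+ 2.
  by transitivity ((m + y) ^+ 2 - 2 * (m * y)); [ring | rewrite two0; ring].
have mc (y : K) : m + in_alg L y != 0.
  apply: contraNneq (q2 0 (- y ^+ 2)) => e; apply/eqP.
  by transitivity ((m + in_alg L y) * (m - in_alg L y)); [ring|rewrite e mul0r].
have [k0 ? e0] := norm_sqr mF m0.
have cF (y : K) : m + in_alg L y \in F by have := alg_mem F y; rewrite -in_algE => ?; solve_mem.
have [k1 ? e1] := norm_sqr (cF 1) (mc 1).
have [k2 ? e2] := norm_sqr (cF c) (mc c).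
exists (m ^+ 2), 1, (c ^+ 2), k0, k1, k2; split.
- by split; [solve_mem | solve_mem | exact: oner_neq0].
- rewrite divr1; apply/negP => /mem1P[k]; rewrite -in_algE => kE.
  case/negP: (q2 0 k); rewrite -kE; apply/eqP; ring.
- by split=> //; rewrite expf_eq0.
rewrite e0 -e1 -e2; split=> //; first by rewrite -sq rmorph1 expr1n.
by rewrite -sq rmorphXn mulr1.
Qed.

(* Any polynomial n taking square values at 0 and 1 is of the form A^2 + A B R + B^2 F
   with B = X (X - 1) and A affine. *)
Lemma square_interpolation (n : {poly K}) (k0 k1 : K) : (size n <= 8)%N ->
  k0 != 0 -> k1 != 0 -> n.[0] = k0 ^+ 2 -> n.[1] = k1 ^+ 2 ->
  exists r1 r0 (f : {poly K}), (size f <= 4)%N /\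
    let A := (k1 - k0)%:P * 'X + k0%:P in let B := 'X * ('X - 1) in
    n = A ^+ 2 + A * B * (r1%:P * 'X + r0%:P) + B ^+ 2 * f.
Proof.
move=> sn k0n k1n n0 n1; pose A := (k1 - k0)%:P * 'X + k0%:P.
have sAff (p q : K) : (size (p%:P * 'X + q%:P)%R <= 2)%N.
  by rewrite mul_polyC (leq_trans (size_polyD _ _)) // geq_max
    (leq_trans (size_scale_leq _ _)) ?size_polyX // (leq_trans (size_polyC_leq1 _)).
have A0 : A.[0] = k0 by rewrite !(hornerD, hornerM, hornerC, hornerX); ring.
have A1 : A.[1] = k1 by rewrite !(hornerD, hornerM, hornerC, hornerX); ring.
have one : 0 != 1 :> K by rewrite eq_sym oner_neq0.
have [S SE sS] : exists2 S, n - A ^+ 2 = ('X - 0%:P) * ('X - 1%:P) * S & (size S <= 6)%N.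
  apply: poly_two_roots => //; rewrite ?hornerD ?hornerN ?horner_exp ?A0 ?A1 ?n0 ?n1 ?subrr //.
  rewrite (leq_trans (size_polyD _ _)) // geq_max size_polyN sn.
  rewrite expr2 (leq_trans (size_polyMleq _ _)) //.
  by have sA := sAff (k1 - k0) k0; rewrite -subn1 leq_subLR (leq_trans (leq_add sA sA)).
(* R is the affine polynomial for which A R agrees with S at 0 and 1. *)
pose r0 := S.[0] / k0; pose r1 := S.[1] / k1 - r0; pose R := r1%:P * 'X + r0%:P.
have [f fE sf] : exists2 f, S - A * R = ('X - 0%:P) * ('X - 1%:P) * f & (size f <= 4)%N.
  apply: poly_two_roots => //.
  - rewrite (leq_trans (size_polyD _ _)) // geq_max size_polyN sS.
    rewrite (leq_trans (size_polyMleq _ _)) //.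
    by rewrite -subn1 leq_subLR (leq_trans (leq_add (sAff _ _) (sAff _ _))).
  - rewrite hornerD hornerN hornerM A0 !(hornerD, hornerM, hornerC, hornerX) /r0.
    by field.
  - rewrite hornerD hornerN hornerM A1 !(hornerD, hornerM, hornerC, hornerX) /r1 /r0.
    by rewrite mulr1 subrK mulrC divfK // subrr.
exists r1, r0, f; split=> //=; rewrite -/A -/R.
have -> : n = A ^+ 2 + ('X - 0%:P) * ('X - 1%:P) * S by rewrite -SE addrC subrK.
have -> : S = A * R + ('X - 0%:P) * ('X - 1%:P) * f by rewrite -fE addrC subrK.
by rewrite subr0; ring.
Qed.

(* For n = A^2 + A B R + B^2 f, the cubic t z^2 - (t R + B) z + t f - A = 0 has the
   points z = - A / B above the roots of n, and z = - (A + k2 v) / B above X = x, where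
   v^2 + k v + 1 = 0 with k affine in 1 / t. *)
Lemma case_2_7 F2 F7 : \dim F2 = 2%N -> \dim F7 = 7%N -> \dim {:L} = 14%N ->
  infinitely_many_new L.
Proof.
move=> d2 d7 dL; have d47 : (4 < \dim F7)%N by rewrite d7.
have [P [D [x [k0 [k1 [k2 [[PF DF Dn] PD1 [x0 x1 [k0n k1n k2n]] [N0 N1 N2]]]]]]]]
  := square_norms d47.
set xi := - P / D in PD1; have xiF : xi \in F7 by rewrite /xi; solve_mem.
have gxi : generates F7 xi by apply: generates_prime; rewrite ?d7.
have [n nE] := norm_polyP L_abelian PF DF.
have evE (y : K) : in_alg L n.[y] = N F7 (P + y%:A * D).
  by rewrite -norm_poly_eval -nE -horner_map.
have n0 : n.[0] = k0 ^+ 2.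
  by apply: (fmorph_inj (in_alg L)); apply: etrans (evE 0) _; rewrite scale0r mul0r addr0.
have n1 : n.[1] = k1 ^+ 2.
  by apply: (fmorph_inj (in_alg L)); apply: etrans (evE 1) _; rewrite scale1r mul1r.
have nx : n.[x] = k2 ^+ 2.
  by apply: (fmorph_inj (in_alg L)); apply: etrans (evE x) _.
have nxi : (map_poly (in_alg L) n).[xi] = 0.
  by rewrite nE norm_poly_root // /xi divfK // subrr.
have sn : (size n <= 8)%N.
  by rewrite -(size_map_poly (in_alg L)) nE (leq_trans (size_norm_poly L_abelian _ _ _)) ?d7.
have [r1 [r0 [f [sf /= nDec]]]] := square_interpolation sn k0n k1n n0 n1.
pose a := k1 - k0.
have nL (y : L) : (map_poly (in_alg L) n).[y]
   = let A := in_alg L a * y + in_alg L k0 in let B := y * (y - 1) in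
     A ^+ 2 + A * B * (in_alg L r1 * y + in_alg L r0)
      + B ^+ 2 * (map_poly (in_alg L) f).[y].
  rewrite nDec -/a !(rmorphD, rmorphM, rmorphN) /= !map_polyX !map_polyC ?rmorph1.
  rewrite !(hornerD, hornerM, hornerN, hornerX, hornerC) -!in_algE; ring.
pose B2 := x * (x - 1).
have B2n : B2 != 0 by rewrite mulf_neq0 // subr_eq0.
pose A2 := a * x + k0.
(* Put z = - (A2 + k2 v) / B2 in the cubic above X = x. Since n takes the value k2^2 there,
   multiplying by B2^2 leaves t k2^2 (v^2 + (l + k / t) v + 1). *)
pose l := (2 * A2 + (r1 * x + r0) * B2) / k2.
pose k := B2 ^+ 2 / k2.
have kn : k != 0 by rewrite mulf_neq0 ?expf_neq0 ?invr_eq0.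
pose T : set K := [set t | t != 0 /\ exists v : L, [/\ v \in F2, v \notin 1%VS &
  v ^+ 2 + in_alg L (l + k / t) * v + 1 = 0]]%classic.
have infT : infinite_set T.
  move=> fT; apply: (infinite_norm_one d2).
  have : finite_set ([set l] `|` (fun t => l + k / t) @` T)%classic.
    by rewrite finite_setU; split=> //; apply: finite_image.
  apply: sub_finite_set => kap /= [v vP].
  have [->|kl] := eqVneq kap l; [by left | right].
  have kl0 : kap - l != 0 by rewrite subr_eq0.
  have e : l + k / (k / (kap - l)) = kap by rewrite invfM invrK mulrA mulfV // mul1r addrC subrK.
  exists (k / (kap - l)) => //; split; first by rewrite mulf_neq0 ?invr_eq0.
  by exists v; rewrite e.
pose c : zcubic {poly K} := ZCubic 'X (- 1) (1 - r1 *: 'X) (- (r0 *: 'X))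
  (f`_3 *: 'X) (f`_2 *: 'X) (f`_1 *: 'X - a%:P) (f`_0 *: 'X - k0%:P).
have zE t (X z : L) : zval (zmap (in_alg L) (zmap (horner_eval t) c)) X z
    = in_alg L t * z ^+ 2
      - (in_alg L t * (in_alg L r1 * X + in_alg L r0) + X * (X - 1)) * z
      + (in_alg L t * (map_poly (in_alg L) f).[X] - (in_alg L a * X + in_alg L k0)).
  rewrite (horner_map4 _ _ sf) /zval /= /horner_eval.
  rewrite !(hornerX, hornerZ, hornerD, hornerN, hornerC) -!in_algE; ring.
apply: (infinite_two_nodes infT (c := c)).
  split=> //=; rewrite ?(hornerX, hornerZ, hornerD, hornerN, hornerC).
  - by split; ring.
  - by rewrite mulr0 sub0r oppr_eq0.
  - by rewrite !mulr0 !add0r -opprD subrK oppr_eq0.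
move=> t [t0 [v [vF v1 ve]]] d; have tL : in_alg L t != 0 by rewrite fmorph_eq0.
have Bxi : xi * (xi - 1) != 0.
  rewrite mulf_neq0 ?subr_eq0 //; first by apply: contraNneq PD1 => ->; apply: mem0v.
  by apply: contraNneq PD1 => ->; apply: mem1v.
have on7 : zval (zmap (in_alg L) (zmap (horner_eval t) c)) xi
    (- (in_alg L a * xi + in_alg L k0) / (xi * (xi - 1))) = 0.
  have := nL xi; rewrite nxi /= => e; rewrite zE.
  apply: (mulIf (expf_neq0 2 Bxi)); rewrite mul0r -(mulr0 (in_alg L t)) [in RHS]e.
  move: Bxi; rewrite mulf_eq0 negb_or => /andP[? ?].
  by rewrite -!in_algE; field; apply/andP.
have z7 : - (in_alg L a * xi + in_alg L k0) / (xi * (xi - 1)) \in F7.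
  by have := alg_mem F7 a; have := alg_mem F7 k0; rewrite -!in_algE => ? ?; solve_mem.
have p7 := zpoint d on7 gxi.1 z7 (fun G xG _ => gxi.2 G xG).
have k2L : in_alg L k2 != 0 by rewrite fmorph_eq0.
have on2 : zval (zmap (in_alg L) (zmap (horner_eval t) c)) (in_alg L x)
    (- (in_alg L A2 + in_alg L k2 * v) / in_alg L B2) = 0.
  have B2L : in_alg L B2 != 0 by rewrite fmorph_eq0.
  have := nL (in_alg L x); rewrite horner_map /= nx -!in_algE => e.
  rewrite zE; apply: (mulIf (expf_neq0 2 B2L)); rewrite mul0r.
  have -> : in_alg L A2 = in_alg L a * in_alg L x + in_alg L k0 by rewrite /A2; ring.
  have B2E : in_alg L B2 = in_alg L x * (in_alg L x - 1) by rewrite /B2; ring.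
  have h1 : in_alg L l * in_alg L k2 = 2 * (in_alg L a * in_alg L x + in_alg L k0)
      + (in_alg L r1 * in_alg L x + in_alg L r0) * in_alg L B2.
    by rewrite -rmorphM /l divfK // /A2; ring.
  have h2 : in_alg L k * in_alg L k2 = in_alg L B2 ^+ 2.
    by rewrite -rmorphM /k divfK // rmorphXn.
  have h3 : in_alg L (l + k / t) = in_alg L l + in_alg L k / in_alg L t.
    by rewrite rmorphD; congr (_ + _); rewrite fmorph_div.
  have h4 : in_alg L (k2 ^+ 2) = in_alg L k2 ^+ 2 by rewrite rmorphXn.
  move: h1 h2 ve e; rewrite h3 -B2E h4.
  move: (in_alg L t) tL (in_alg L k2) k2L (in_alg L B2) B2L B2E => t' tL k' k2L B B2L B2E.
  move: (in_alg L a) (in_alg L k0) (in_alg L r1) (in_alg L r0) (in_alg L x) (in_alg L l)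
    (in_alg L k) ((map_poly _ f).[_]) B2E => a' k0' r1' r0' x' l' m f' B2E h1 h2 ve e.
  transitivity (k' * t' * (v ^+ 2 + (l' + m / t') * v + 1) * k'
     - t' * (k' ^+ 2 - ((a' * x' + k0') ^+ 2 + (a' * x' + k0') * B * (r1' * x' + r0')
                 + B ^+ 2 * f'))
     - k' * t' * v * (l' * k' - (2 * (a' * x' + k0') + (r1' * x' + r0') * B))
     - k' * v * (m * k' - B ^+ 2)).
    by field; rewrite tL B2L.
  by rewrite ve h1 h2 {1}e; ring.
have z2 : - (in_alg L A2 + in_alg L k2 * v) / in_alg L B2 \in F2.
  by have := alg_mem F2 A2; have := alg_mem F2 k2; have := alg_mem F2 B2;
    rewrite -!in_algE => ? ? ?; solve_mem.
have g2 G : in_alg L x \in G ->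
    - (in_alg L A2 + in_alg L k2 * v) / in_alg L B2 \in G -> (F2 <= G)%VS.
  move=> _ zG; apply: (generates_prime _ vF v1).2; first by rewrite d2.
  have B2L : in_alg L B2 != 0 by rewrite fmorph_eq0.
  have -> : v = - (- (in_alg L A2 + in_alg L k2 * v) / in_alg L B2 * in_alg L B2
     + in_alg L A2) / in_alg L k2.
    by field; rewrite B2L k2L.
  by have := alg_mem G A2; have := alg_mem G k2; have := alg_mem G B2;
    rewrite -!in_algE => ? ? ?; solve_mem.
have p2 := zpoint d on2 (alg_mem F2 x) z2 g2.
have [|||Q qf] := point_field_chord L_abelian _ _ _ p2 p7; rewrite ?d2 ?d7 //.
move: qf; rewrite prod_full ?d2 ?d7 ?dL //; exact: point_field_new.
Qed.

End Degree14.

(** * Degree 20 *)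

Section QuinticModel.
Variable R : comNzRingType.
Variables h r2 r1 n1 n2 n3 n4 n5 : R.

(* Whatever r2 and r1 are, this cubic takes the value h (1 + n1 X + ... + n5 X^5) / X^2
   at z = 1 / X. *)
Definition quintic_model := ZCubic h r2 r1 (h * n1) (h * n5) (h * n4)
  (h * n3 - r2) (h * n2 - r1).

(** Here a2, a3, a4 and a6 are the coefficients of [zw] freed of the factors h, h, h and h^3. Since
    a4 + r1 a3 = h g, the invariant b8 equals h^3 d8, whence the factor h^3 of the discriminant. *)
Definition quintic_cofactor : R :=
  let a2 := - (h * n4 + n1 * r2) in
  let a3 := h ^+ 2 * n1 * n5 - r2 * (h * n3 - r2) in
  let a4 := h ^+ 2 * n1 * r2 * n4 - h ^+ 2 * n1 * r1 * n5 + r2 ^+ 2 * (h * n2 - r1)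
    + h ^+ 2 * (h * n3 - r2) * n5 in
  let a6 := - ((r2 ^+ 2 * n4 + h ^+ 2 * n5 ^+ 2 - r1 * r2 * n5) * (h * n2 - r1)) in
  let g := - (r1 * r2 * n3) + h * n1 * r2 * n4 + r2 ^+ 2 * n2
    + h * (h * n3 - r2) * n5 in
  let d8 := r1 ^+ 2 * a6 + 4 * h * a2 * a6 - a4 * g + a2 * a3 ^+ 2 in
  let b2 := r1 ^+ 2 + 4 * h * a2 in
  let b4 := 2 * a4 + r1 * a3 in
  let b6 := a3 ^+ 2 + 4 * h * a6 in
  - (b2 ^+ 2 * d8) - 8 * b4 ^+ 3 - 27 * h * b6 ^+ 2 + 9 * b2 * b4 * b6.

Lemma disc_quintic_model : disc (zw quintic_model) = h ^+ 3 * quintic_cofactor.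
Proof. by rewrite /disc /quintic_cofactor /=; ring. Qed.

(** For h = 0 the cubic splits as (r2 X + r1) (X z - 1). The last factor is r2^5 n(- r1 / r2), where
    n = 1 + n1 X + ... + n5 X^5. *)
Lemma quintic_cofactor0 : h = 0 ->
  quintic_cofactor = - (r1 ^+ 3 * r2 * (r2 ^+ 5 - n1 * r1 * r2 ^+ 4
    + n2 * r1 ^+ 2 * r2 ^+ 3 - n3 * r1 ^+ 3 * r2 ^+ 2 + n4 * r1 ^+ 4 * r2
    - n5 * r1 ^+ 5)).
Proof. by move=> h0; rewrite /quintic_cofactor h0; ring. Qed.

Lemma inv4_quintic_model0 : h = 0 -> inv4 (zw quintic_model) = r1 ^+ 4.
Proof. by move=> h0; rewrite /inv4 /= h0; ring. Qed.

End QuinticModel.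

Lemma quintic_model_map (R S : comNzRingType) (f : {rmorphism R -> S})
    h r2 r1 n1 n2 n3 n4 n5 :
  zmap f (quintic_model h r2 r1 n1 n2 n3 n4 n5)
  = quintic_model (f h) (f r2) (f r1) (f n1) (f n2) (f n3) (f n4) (f n5).
Proof. by rewrite /zmap /quintic_model /=; congr ZCubic; ring. Qed.

Lemma quintic_cofactor_map (R S : comNzRingType) (f : {rmorphism R -> S})
    h r2 r1 n1 n2 n3 n4 n5 :
  quintic_cofactor (f h) (f r2) (f r1) (f n1) (f n2) (f n3) (f n4) (f n5)
  = f (quintic_cofactor h r2 r1 n1 n2 n3 n4 n5).
Proof. by rewrite /quintic_cofactor /=; ring. Qed.

Lemma infinite_nonroots (K M : fieldType) (iota : {rmorphism K -> M}) (p : {poly M}) :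
  infinite_set [set: K]%classic -> p != 0 ->
  infinite_set [set t : K | p.[iota t] != 0]%classic.
Proof.
move=> infK p0 fin; apply: infK.
have : finite_set ([set t : K | p.[iota t] != 0] `|` [set t : K | p.[iota t] = 0])%classic.
  by rewrite finite_setU; split=> //; apply: finite_roots.
by apply: sub_finite_set => t _; have [e|n] := eqVneq p.[iota t] 0; [right | left].
Qed.

Section QuadraticConjugation.
Variables (K : fieldType) (L : splittingFieldType K).
Hypothesis L_abelian : abelian_extension L.
Implicit Types (F G U : {subfield L}).
Local Notation "''Gal' ( V / U )" := (galoisG V U) : ring_scope.

Lemma generates_quadratic F a (p q : K) : generates F a -> (2 < \dim F)%N ->
  a ^+ 2 + in_alg L p * a + in_alg L q != 0.
Proof.
move=> ga d; have sR : (size (p%:P * 'X + q%:P)%R <= 2)%N.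
  by rewrite mul_polyC (leq_trans (size_polyD _ _)) // geq_max
    (leq_trans (size_scale_leq _ _)) ?size_polyX // (leq_trans (size_polyC_leq1 _)).
have sp : size ('X^2 + (p%:P * 'X + q%:P)) = 3 by rewrite size_polyDl size_polyXn // ltnS.
have := generates_indep ga; move=> /(_ ('X^2 + (p%:P * 'X + q%:P))).
rewrite -size_poly_eq0 sp => /(_ isT d).
rewrite !(rmorphD, rmorphM) /= !map_polyX !map_polyC.
rewrite !(hornerD, hornerM, hornerC, hornerX) -!in_algE -expr2 addrA; exact.
Qed.

Lemma generates_step U F a : (U <= F)%VS -> \dim_U F = 2%N -> a \in F -> a \notin U ->
  forall G, (U <= G)%VS -> a \in G -> (F <= G)%VS.
Proof.
move=> sU dF aF aU G UG aG; apply: subv_trans (_ : (<<U; a>> <= G)%VS); last first.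
  by apply/FadjoinP.
have sF : (<<U; a>> <= F)%VS by apply/FadjoinP.
have dvU := field_dimS (subv_adjoin U a); have dvF := field_dimS sF.
have dE : \dim F = (2 * \dim U)%N by rewrite -dF divnK ?field_dimS.
case/dvdnP: dvU => m mE.
have U0 := adim_gt0 U.
have : (m %| 2)%N by rewrite -(dvdn_pmul2r U0) -mE -dE.
case/(primeP (isT : prime 2)).2/orP => /eqP m1; rewrite m1 ?mul1n -?dE in mE.
  have /eqP UE : (U == <<U; a>>%AS :> {vspace L})%VS.
    by rewrite eqEdim subv_adjoin mE leqnn.
  by case/negP: aU; rewrite UE; apply: memv_adjoin.
have /eqP -> // : (F == <<U; a>>%AS :> {vspace L})%VS.
by rewrite eq_sym eqEdim sF mE leqnn.
Qed.

Lemma quadratic_conj_inv U F : galois U F -> \dim_U F = 2%N ->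
  exists2 s, s \in 'Gal(F / U) & forall b, b \in F ->
    [/\ b + s b \in U, b * s b \in U, s (s b) = b & s b = b -> b \in U].
Proof.
move=> gF dF; have [s sG sP] := quadratic_conj gF dF; exists s => // b bF.
have [bD bM bU] := sP b bF; split=> //.
have sU : (U <= F)%VS by case/and3P: gF.
have := fixed_gal sU sG bD; rewrite rmorphD /= addrC => /addIr; exact.
Qed.

(** The coordinate of b along th is (b - s b) / (th - s th), which is fixed by s. *)
Lemma quadratic_coords F s th : \dim F = 2%N -> s \in 'Gal(F / 1) ->
  (forall b, b \in F -> [/\ b + s b \in 1%VS, b * s b \in 1%VS, s (s b) = b
     & s b = b -> b \in 1%VS]) -> th \in F -> th \notin 1%VS ->
  forall p : {poly L}, p \is a polyOver F -> exists p2 p1 : {poly K},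
    p = th *: map_poly (in_alg L) p2 + map_poly (in_alg L) p1.
Proof.
move=> dF sG sP thF th1 p pF.
have [_ _ _ sth] := sP th thF.
have thn : th - s th != 0.
  by rewrite subr_eq0; apply: contraNneq th1 => /esym/sth.
have sF b : b \in F -> s b \in F by apply: memv_gal.
have fixK b : b \in F -> s b = b -> exists k : K, b = in_alg L k.
  by move=> bF sb; have [_ _ _ /(_ sb)/mem1P] := sP b bF.
have coord b : b \in F -> exists k : K * K, b = th * in_alg L k.1 + in_alg L k.2.
  move=> bF; have [_ _ sb _] := sP b bF; have [_ _ ss _] := sP th thF.
  have [k2 k2E] : exists k : K, (b - s b) / (th - s th) = in_alg L k.
    apply: fixK.
      by have := sF b bF; have := sF th thF => ? ?; solve_mem.
    rewrite fmorph_div !rmorphB /= sb ss -[s b - b]opprB -[s th - th]opprB.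
    by rewrite invrN mulrNN.
  have e : b - s b = in_alg L k2 * (th - s th) by rewrite -k2E divfK.
  have [k1 k1E] : exists k : K, b - th * in_alg L k2 = in_alg L k.
    apply: fixK; first by have := alg_mem F k2; rewrite -in_algE => ?; solve_mem.
    rewrite rmorphB rmorphM /= linearZ /= rmorph1 -in_algE.
    apply/eqP; rewrite -subr_eq0; apply/eqP.
    transitivity (in_alg L k2 * (th - s th) - (b - s b)); first by ring.
    by rewrite e subrr.
  by exists (k2, k1); apply/eqP; rewrite addrC -subr_eq; apply/eqP.
have /choice[k kE] : forall i, exists k : K * K, p`_i = th * in_alg L k.1 + in_alg L k.2.
  by move=> i; apply: coord; apply: (polyOverP pF).
exists (\poly_(i < size p) (k i).1), (\poly_(i < size p) (k i).2).
apply/polyP => i; rewrite coefD coefZ !coef_map !coef_poly /=.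
case: ltnP => [_|le]; first exact: kE.
by rewrite !scale0r mulr0 addr0 nth_default.
Qed.

Lemma quadratic_norm_poly F s (p : {poly L}) : \dim F = 2%N -> s \in 'Gal(F / 1) ->
  (forall b, b \in F -> [/\ b + s b \in 1%VS, b * s b \in 1%VS, s (s b) = b
     & s b = b -> b \in 1%VS]) -> p \is a polyOver F ->
  exists q : {poly K}, map_poly (in_alg L) q = p * map_poly s p.
Proof.
move=> dF sG sP pF.
suff /polyOver1P[q ->] : p * map_poly s p \is a polyOver 1%VS by exists q.
have spF : map_poly s p \is a polyOver F.
  by apply/polyOverP => i; rewrite coef_map memv_gal // (polyOverP pF).
have qF : p * map_poly s p \is a polyOver F by apply: rpredM.
apply/polyOverP => i; have [_ _ _] := sP _ (polyOverP qF i); apply.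
rewrite -coef_map rmorphM /= mulrC; congr (polyseq _)`_i; congr (_ * _).
apply/polyP => j; rewrite !coef_map /=.
by have [_ _ -> _] := sP _ (polyOverP pF j).
Qed.

End QuadraticConjugation.

Section Degree20.
Variables (K : fieldType) (L : splittingFieldType K).
Hypothesis L_abelian : abelian_extension L.
Hypothesis K_infinite : infinite_set [set: K]%classic.
Implicit Types (F G : {subfield L}).
Local Notation N F := (galNorm 1 F).
Local Notation "''Gal' ( V / U )" := (galoisG V U) : ring_scope.

Lemma norm_poly_horner F (P D x : L) :
  (norm_poly F P D).[x] = \prod_(s in 'Gal(F / 1)) (s P + s D * x).
Proof.
by rewrite horner_prod; apply: eq_bigr => s _; rewrite hornerD hornerC hornerZ hornerX.
Qed.

Lemma norm_poly_mem F G (P D x : L) : P \in F -> D \in F -> x \in G ->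
  (norm_poly F P D).[x] \in G.
Proof.
move=> PF DF xG; have [n <-] := norm_polyP L_abelian PF DF.
by apply: rpred_horner => //; apply/polyOverP => i; rewrite coef_map alg_mem.
Qed.

(** In characteristic 2, 1 - p^2 / b^2 is already a square. Otherwise take [dl] in F2 with square d
    in K: then g and th satisfy 1 - g th = (s0 / p) ((p + dl) / (s0 + dl))^2. Over the five
    conjugates of p the factors s0 / p multiply to s0^5 / N(p), and the choice s0 = N(p) turns this
    into the square s0^4. *)
Lemma square_at_quadratic F2 F5 : \dim F2 = 2%N -> \dim F5 = 5%N ->
  exists g th sg : L, [/\ [/\ g \in F5, g \notin 1%VS, th \in F2, th \notin 1%VS & sg \in F2],
    sg != 0 & (norm_poly F5 1 (- g)).[th] = sg ^+ 2].
Proof.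
move=> d2 d5; have d45 : (4 < \dim F5)%N by rewrite d5.
have [p gp] := generates_ex L_abelian F5; have pF := gp.1.
have q4 := generates_quartic _ _ _ _ gp d45.
have q2 (c1 c0 : K) : p ^+ 2 + in_alg L c1 * p + in_alg L c0 != 0.
  apply: contraNneq (q4 c1 c0 0 0) => e; apply/eqP.
  by transitivity (p ^+ 2 * (p ^+ 2 + in_alg L c1 * p + in_alg L c0)); [ring|rewrite e mulr0].
have p0 : p != 0.
  by apply: contraNneq (q2 0 0) => ->; apply/eqP; ring.
have card5 : #|'Gal(F5 / 1)| = 5%N by rewrite card_gal1.
have [b [T [n [bF b1 bE Tn]]]] := quadratic_gen L_abelian d2.
rewrite -!in_algE in bE.
have indep y : y \in F2 -> y \notin 1%VS -> forall s : gal_of F5, s p + s 1 * y != 0.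
  move=> yF y1 s; rewrite rmorph1 mul1r; apply/eqP => e.
  have yF5 : y \in F5.
    have -> : y = - s p by apply/eqP; rewrite -addr_eq0 addrC e.
    by rewrite rpredN memv_gal.
  have s25 : (F2 <= F5)%VS by apply: (generates_prime _ yF _).2; rewrite ?d2.
  by have := field_dimS s25; rewrite d2 d5.
have [c2|c2] := boolP (2%N \in [pchar K]).
  have two0 : 2 = 0 :> L by rewrite -(rmorph_nat (in_alg L)) (pcharf0 c2) rmorph0.
  have T0 : T != 0.
    apply: contraNneq Tn => ->; rewrite expr0n /= (_ : 4 = 2 * 2 :> K); last by ring.
    by rewrite (pcharf0 c2) !mul0r.
  have b0 : b != 0 by apply: contraNneq b1 => ->; apply: mem0v.
  have bb : b ^+ 2 \notin 1%VS.
    apply: contra b1 => /mem1P[k]; rewrite -in_algE => kE.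
    have -> : b = in_alg L ((k + n) / T).
      have TL : in_alg L T != 0 by rewrite fmorph_eq0.
      apply: (mulIf TL); rewrite -rmorphM divfK //.
      by transitivity (b ^+ 2 + in_alg L n); [rewrite bE | rewrite kE]; ring.
    exact: (alg_mem 1%AS).
  pose M := (norm_poly F5 p 1).[b].
  exists (p ^+ 2), (b ^+ 2)^-1, (M / b ^+ 5); split.
  - split; try by [rewrite rpredV | solve_mem].
    + apply/negP => /mem1P[k]; rewrite -in_algE => kE.
      by case/negP: (q2 0 (- k)); rewrite kE; apply/eqP; ring.
    + by have := @norm_poly_mem F5 F2 p 1 b pF (mem1v _) bF; rewrite -/M => ?; solve_mem.
  - rewrite mulf_neq0 ?invr_eq0 ?expf_neq0 // /M norm_poly_horner prodf_seq_neq0.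
    by apply/allP => s _; rewrite indep ?implybT.
  rewrite norm_poly_horner.
  transitivity (\prod_(s in 'Gal(F5 / 1)) ((b ^+ 2)^-1 * (s p + s 1 * b) ^+ 2)).
    apply: eq_bigr => s _; rewrite rmorphN rmorphXn rmorph1 /=.
    transitivity ((b ^+ 2)^-1 * ((s p + 1 * b) ^+ 2 - 2 * (s p * b + (s p) ^+ 2))).
      by field.
    by rewrite two0; ring.
  rewrite big_split prodrXl -norm_poly_horner -/M prodr_const card5.
  by rewrite /=; field.
have n2 : 2 != 0 :> K by apply: contra c2; rewrite inE.
have n2L : 2 != 0 :> L by rewrite -(rmorph_nat (in_alg L)) fmorph_eq0.
have [h TE] : exists h, T = 2 * h by exists (T / 2); field.
pose dl := b - in_alg L h.
have [d dlE] : exists d : K, dl ^+ 2 = in_alg L d.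
  exists (h ^+ 2 - n); rewrite /dl -[RHS]addr0 -(subrr (in_alg L T * b - in_alg L n)) -{1}bE TE; ring.
have dlF : dl \in F2 by have := alg_mem F2 h; rewrite -in_algE /dl => ?; solve_mem.
have dl1 : dl \notin 1%VS.
  apply: contra b1 => dl1; rewrite -[b](subrK (in_alg L h)) rpredD //.
  exact: (alg_mem 1%AS).
have [s0 s0E] := norm_in L_abelian pF; rewrite -in_algE in s0E.
have s0n : in_alg L s0 != 0 by rewrite -[X in X != 0]s0E galNorm_eq0.
have s0K : s0 != 0 by rewrite -(fmorph_eq0 (in_alg L)).
have sdn : in_alg L s0 + dl != 0.
  apply: contraNneq dl1 => e.
  have -> : dl = - in_alg L s0 by apply/eqP; rewrite -addr_eq0 addrC e.
  by rewrite rpredN; apply: (alg_mem 1%AS).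
have sF (F : {subfield L}) (k : K) : in_alg L k \in F by rewrite in_algE alg_mem.
pose M := (norm_poly F5 p 1).[dl].
exists ((in_alg L s0 - p) * (in_alg L s0 - in_alg L d / p)), ((in_alg L s0 + dl) ^+ 2)^-1,
  (in_alg L s0 ^+ 2 * M / (in_alg L s0 + dl) ^+ 5).
split.
- have := sF F2 s0; have := sF F5 s0; have := sF F5 d => ? ? ?.
  split; try solve_mem.
  + apply/negP => /mem1P[k]; rewrite -in_algE => kE.
    case/negP: (q2 ((k - s0 ^+ 2 - d) / s0) d); apply/eqP.
    have -> : in_alg L ((k - s0 ^+ 2 - d) / s0)
        = (in_alg L k - in_alg L s0 ^+ 2 - in_alg L d) / in_alg L s0.
      by rewrite fmorph_div; congr (_ / _); ring.
    by rewrite -kE; field; rewrite s0n p0.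
  + rewrite rpredV; apply: contra dl1 => /mem1P[k]; rewrite -in_algE => kE.
    have -> : dl = in_alg L ((k - s0 ^+ 2 - d) / (2 * s0)).
      have s2 : in_alg L (2 * s0) != 0 by rewrite rmorphM rmorph_nat mulf_neq0.
      apply: (mulIf s2); rewrite -rmorphM divfK ?mulf_neq0 //.
      transitivity (in_alg L k - in_alg L s0 ^+ 2 - in_alg L d); last by ring.
      by rewrite -kE -dlE; ring.
    exact: (alg_mem 1%AS).
  + by have := @norm_poly_mem F5 F2 p 1 dl pF (mem1v _) dlF; rewrite -/M => ?; solve_mem.
- rewrite !mulf_neq0 ?invr_eq0 ?expf_neq0 // /M norm_poly_horner prodf_seq_neq0.
  by apply/allP => s _; rewrite indep ?implybT.
rewrite norm_poly_horner.
transitivity (\prod_(s in 'Gal(F5 / 1)) (in_alg L s0 / (in_alg L s0 + dl) ^+ 2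
    * (s p)^-1 * (s p + s 1 * dl) ^+ 2)).
  apply: eq_bigr => s _; have sK (k : K) : s (in_alg L k) = in_alg L k.
    by rewrite /= linearZ /= rmorph1.
  have sp0 : s p != 0 by rewrite fmorph_eq0.
  have -> : s (- ((in_alg L s0 - p) * (in_alg L s0 - in_alg L d / p)))
      = - ((in_alg L s0 - s p) * (in_alg L s0 - dl ^+ 2 / s p)).
    transitivity (- ((s (in_alg L s0) - s p) * (s (in_alg L s0) - s (in_alg L d) / s p))).
      by rewrite rmorphN rmorphM !rmorphB rmorphM fmorphV.
    by rewrite !sK dlE.
  by rewrite rmorph1; field; rewrite sdn sp0.
rewrite big_split big_split prodrXl -norm_poly_horner -/M prodr_const card5.
rewrite /= prodfV -[\prod_(s in _) (s : gal_of F5) p]/(N F5 p) s0E.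
by rewrite -!in_algE; field; rewrite s0n sdn.
Qed.

(* Above X = th the cubic has the points z = (1 + sg v) / th with v^2 + k v + 1 = 0,
   where k determines th (p2 th + p1); taking v = (b + t) / (r b + t), of norm 1 over F2,
   gives p2 and p1 after scaling by the norm h of b + t. The nodal fiber is at the
   irrational value t = -b. *)
Lemma case_4_5 F2 F4 F5 : (F2 <= F4)%VS ->
  \dim F2 = 2%N -> \dim F4 = 4%N -> \dim F5 = 5%N -> \dim {:L} = 20%N ->
  infinitely_many_new L.
Proof.
move=> s24 d2 d4 d5 dL.
have [g [th [sg [[gF g1 thF th1 sgF] sg0 sgE]]]] := square_at_quadratic d2 d5.
have gF' : - g \in F5 by rewrite rpredN.
have [n nE] := norm_polyP L_abelian (mem1v F5) gF'.
have d51 : (1 < \dim F5)%N by rewrite d5.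
have gg : generates F5 g by apply: generates_prime; rewrite ?d5.
have g0 : g != 0 := generates_eq0 gg d51.
have sn : (size n <= 6)%N.
  by rewrite -(size_map_poly (in_alg L)) nE (leq_trans (size_norm_poly L_abelian _ _ _)) ?d5.
have n0 : n`_0 = 1.
  apply: (fmorph_inj (in_alg L)); rewrite -horner_coef0 -horner_map /= nE -[0 *: 1]/(0%:A).
  by rewrite norm_poly_eval scale0r mul0r addr0 galNorm1 scale1r.
have nL (X : L) : (map_poly (in_alg L) n).[X] = 1 + in_alg L n`_1 * X
   + in_alg L n`_2 * X ^+ 2 + in_alg L n`_3 * X ^+ 3 + in_alg L n`_4 * X ^+ 4
   + in_alg L n`_5 * X ^+ 5.
  rewrite (@horner_coef_wide _ 6) ?size_map_poly // !big_ord_recl big_ord0.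
  by rewrite !coef_map n0 /= -!in_algE; ring.
have ng : (map_poly (in_alg L) n).[g^-1] = 0.
  by rewrite nE norm_poly_root // mulrN mulVf // subrr.
rewrite -nE in sgE.
have gal2 := galois_sub L_abelian F2.
have [|s sG sP] := quadratic_conj_inv gal2 _; first by rewrite dimv1 divn1.
have gal4 : galois F2 F4 by apply: galoisS (galois_sub L_abelian F4); rewrite sub1v s24.
have d42 : \dim_F2 F4 = 2%N by rewrite d4 d2.
have [r rG rP] := quadratic_conj_inv gal4 d42.
have [b gb] := generates_ex L_abelian F4; have bF := gb.1.
have [T [m [TE mE TF mF]]] : exists T m, [/\ T = b + r b, m = b * r b, T \in F2 & m \in F2].
  by have [TF mF _ _] := rP b bF; exists (b + r b), (b * r b).
have [_ _ _ rb] := rP b bF.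
have bF2 : b \notin F2.
  by apply/negP => /gb.2/dimvS; rewrite d2 d4.
(* At t in K, [pn] is the norm of b + t from F4 to F2 and [ps] is its conjugate over K, so their
   product [h] is the norm of b + t down to K. *)
pose pn : {poly L} := 'X^2 + T *: 'X + m%:P; pose ps := map_poly s pn.
have pnE x : pn.[x] = (b + x) * (r b + x).
  by rewrite !(hornerD, hornerZ, hornerX, hornerXn, hornerC) TE mE; ring.
have psE x : ps.[x] = x ^+ 2 + s T * x + s m.
  rewrite /ps /pn !rmorphD /= map_polyXn map_polyZ map_polyX map_polyC.
  by rewrite !(hornerD, hornerZ, hornerX, hornerXn, hornerC).
have pnF : pn \is a polyOver F2.
  by rewrite !rpredD ?polyOverXn ?polyOverC // polyOverZ ?polyOverX.
have psK : map_poly s ps = pn.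
  by apply/polyP => i; rewrite !coef_map /=; have [_ _ -> _] := sP _ (polyOverP pnF i).
have [h hE] := quadratic_norm_poly d2 sG sP pnF; rewrite -/ps in hE.
pose q : {poly L} := (2 : L) *: pn - (T%:P + (2 : L) *: 'X) ^+ 2.
(* This is the value of th p2 + p1 for which z = (1 + sg v) / th turns the fibre above X = th into
   v^2 + (q / pn) v + 1 = 0; q / pn is minus the trace over F2 of v = (b + t) / (r b + t). *)
pose Y := th ^- 2 *: (sg *: (q * ps) - (2 + in_alg L n`_1 * th) *: (pn * ps)).
have qE x : q.[x] = 2 * pn.[x] - (T + 2 * x) ^+ 2.
  rewrite /q; move: (pn) => p0.
  by rewrite hornerD hornerN hornerZ horner_exp hornerD hornerZ hornerC hornerX.
have YtE x : Y.[x] = th ^- 2 * (sg * (q.[x] * ps.[x])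
    - (2 + in_alg L n`_1 * th) * (pn.[x] * ps.[x])).
  by rewrite /Y hornerZ hornerD hornerN !hornerZ !hornerM.
have psF : ps \is a polyOver F2.
  by apply/polyOverP => i; rewrite coef_map memv_gal // (polyOverP pnF).
have YF : Y \is a polyOver F2.
  have nF : in_alg L n`_1 \in F2 by apply: alg_mem.
  have qF : q \is a polyOver F2.
    rewrite rpredB ?rpredX ?rpredD ?polyOverZ ?polyOverC ?polyOverX //; solve_mem.
  apply: polyOverZ; first by rewrite rpredV rpredX.
  by apply: rpredB; apply: polyOverZ; rewrite ?rpredM //; solve_mem.
have [p2 [p1 YE]] := quadratic_coords d2 sG sP thF th1 YF.
have sK (k : K) : s (in_alg L k) = in_alg L k by rewrite /= linearZ /= rmorph1.
have sKp (p : {poly K}) : map_poly s (map_poly (in_alg L) p) = map_poly (in_alg L) p.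
  by apply/polyP => i; rewrite !coef_map /= -in_algE sK.
have sYE : map_poly s Y = s th *: map_poly (in_alg L) p2 + map_poly (in_alg L) p1.
  by rewrite YE rmorphD /= map_polyZ /= !sKp.
have pnb : pn.[- b] = 0 by rewrite pnE subrr mul0r.
(* If - b were a root, either b would lie in F2, or T and m would be fixed by s, and b would be
   quadratic over K. *)
have psb : ps.[- b] != 0.
  rewrite psE; apply/eqP => e.
  have bE : b ^+ 2 = T * b - m by rewrite TE mE; ring.
  have e' : (T - s T) * b = m - s m by rewrite -[RHS](addr0 _) -[in RHS]e sqrrN bE; ring.
  have [sT|sT] := eqVneq (s T) T; last first.
    case/negP: bF2; have -> : b = (m - s m) / (T - s T).
      by rewrite -e' mulrAC mulfV ?mul1r // subr_eq0 eq_sym.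
    have [sTF smF] : s T \in F2 /\ s m \in F2 by rewrite !memv_gal.
    solve_mem.
  have sm : s m = m by apply/esym/eqP; rewrite -subr_eq0 -e' sT subrr mul0r.
  have [_ _ _ /(_ sT)/mem1P[kT TK]] := sP T TF.
  have [_ _ _ /(_ sm)/mem1P[km mK]] := sP m mF.
  have := generates_quadratic (- kT) km gb; rewrite d4 => /(_ isT)/eqP; apply.
  by rewrite bE rmorphN TK mK -!in_algE; ring.
have Yb : Y.[- b] != 0.
  rewrite YtE qE pnb mul0r !mulr0 subr0 sub0r.
  rewrite !mulf_neq0 ?invr_eq0 ?expf_neq0 //.
    by apply: contraNneq th1 => ->; apply: mem0v.
  rewrite oppr_eq0 expf_neq0 //; apply: contra bF2 => /eqP e; apply: rb.
  by apply/eqP; rewrite -subr_eq0 -[X in _ == X]e TE; apply/eqP; ring.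
have sYb : (map_poly s Y).[- b] = 0.
  rewrite /Y map_polyZ /= rmorphB /= !map_polyZ /= !rmorphM /= psK.
  by rewrite hornerZ hornerD hornerN !hornerZ !hornerM pnb; ring.
set r2 := (map_poly (in_alg L) p2).[- b]; set r1 := (map_poly (in_alg L) p1).[- b].
(* The conjugate of Y contains the factor [pn] and vanishes at - b. So - r1 / r2 = s th, where n
   takes the nonzero value (s sg)^2; this keeps [quintic_cofactor] nonzero. *)
have r1E : r1 = - s th * r2.
  apply/eqP; rewrite mulNr -addr_eq0 addrC -[X in _ == X]sYb sYE.
  by rewrite hornerD hornerZ.
have r2n : r2 != 0.
  apply: contraNneq Yb => e; rewrite YE hornerD hornerZ -/r1 -/r2 r1E e.
  by apply/eqP; ring.
pose c := quintic_model h p2 p1 (n`_1)%:P (n`_2)%:P (n`_3)%:P (n`_4)%:P (n`_5)%:P.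
pose iota := in_alg L.
have hb : (map_poly (in_alg L) h).[- b] = 0 by rewrite hE hornerM pnb mul0r.
(* Parameters with T + 2 t = 0 are left out because they give v = -1. *)
apply: (@infinite_family K L L (in_alg L)
  [set t : K | (T%:P + (2 : L) *: 'X).[in_alg L t] != 0]%classic
  (zmap (map_poly (in_alg L)) c) (- b)).
- apply: infinite_nonroots => //.
  apply/eqP => e; have := congr1 (fun p : {poly L} => p`_0) e.
  have := congr1 (fun p : {poly L} => p`_1) e.
  rewrite /= !coefD !coefZ !coefX !coefC /= => e1 e0.
  move: e0 e1; rewrite add0r mulr1 mulr0 addr0 => e0 e1.
  case/negP: bF2; apply: rb; apply/eqP; rewrite -subr_eq0; apply/eqP.
  by transitivity (T - 2 * b); [rewrite TE; ring | rewrite e0 e1; ring].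
- rewrite quintic_model_map disc_quintic_model mulf_neq0 ?expf_neq0 //.
    rewrite -[X in X != 0]/(map_poly (in_alg L) h) hE mulf_neq0 //; last by apply: contraNneq psb => ->; rewrite horner0.
    rewrite -size_poly_eq0 /pn -addrA size_polyDl size_polyXn // ltnS.
    rewrite (leq_trans (size_polyD _ _)) // geq_max (leq_trans (size_scale_leq _ _)) ?size_polyX //.
    by rewrite (leq_trans (size_polyC_leq1 _)).
  apply/eqP => C0; have nC i : in_alg L n`_i = horner_eval (- b) (map_poly (in_alg L) (n`_i)%:P).
    by rewrite map_polyC; apply/esym; apply: hornerC.
  have : quintic_cofactor 0 r2 r1 (in_alg L n`_1) (in_alg L n`_2) (in_alg L n`_3)
      (in_alg L n`_4) (in_alg L n`_5) = 0.
    have h0 : 0 = horner_eval (- b) (map_poly (in_alg L) h) by rewrite /horner_eval hb.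
    rewrite [X in quintic_cofactor X]h0 !nC -[RHS](horner0 (- b)) -C0.
    exact: (quintic_cofactor_map (horner_eval (- b))).
  rewrite quintic_cofactor0 //; apply/eqP; rewrite oppr_eq0 r1E.
  have sthn : s sg ^+ 2 != 0 by rewrite expf_neq0 // fmorph_eq0.
  have sth0 : s th != 0.
    by rewrite fmorph_eq0; apply: contraNneq th1 => ->; apply: mem0v.
  have e : s sg ^+ 2 = (map_poly (in_alg L) n).[s th].
    by rewrite -rmorphXn -sgE -horner_map /= sKp.
  have : (- s th * r2) ^+ 3 * r2 ^+ 6 * s sg ^+ 2 != 0.
    apply: mulf_neq0 => //; apply: mulf_neq0; apply: expf_neq0 => //.
    by apply: mulf_neq0 => //; rewrite oppr_eq0.
  by apply: contraNneq => e0; rewrite e nL -[X in _ == X]e0; apply/eqP; ring.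
- rewrite quintic_model_map disc_quintic_model hornerM horner_exp hb expr0n /= mul0r //.
- rewrite quintic_model_map -[_.[_]]/(horner_eval (- b) _) -zinv4_map quintic_model_map.
  rewrite inv4_quintic_model0 // expf_neq0 // -[X in X != 0]/r1 r1E mulf_neq0 //.
  rewrite oppr_eq0 fmorph_eq0; apply: contraNneq th1 => ->; apply: mem0v.
move=> t /= Tt; exists (zmap (horner_eval t) c); split.
  by congr ZCubic; apply/esym; apply: (horner_map (in_alg L)).
move=> d.
have cE : zmap (in_alg L) (zmap (horner_eval t) c) = quintic_model (in_alg L h.[t])
  (in_alg L p2.[t]) (in_alg L p1.[t]) (in_alg L n`_1) (in_alg L n`_2) (in_alg L n`_3)
  (in_alg L n`_4) (in_alg L n`_5).
  by rewrite !quintic_model_map; congr quintic_model; congr (in_alg L _); apply: hornerC.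
have h0 : in_alg L h.[t] != 0.
  rewrite fmorph_eq0; apply: contraNneq d => ht.
  rewrite quintic_model_map disc_quintic_model /= /horner_eval ht; apply/eqP; ring.
have hE' : in_alg L h.[t] = pn.[in_alg L t] * ps.[in_alg L t].
  by rewrite -hornerM -hE; apply/esym; apply: (horner_map (in_alg L)).
have YE' : th * in_alg L p2.[t] + in_alg L p1.[t] = Y.[in_alg L t].
  rewrite YE hornerD hornerZ; congr (_ * _ + _);
    apply/esym; apply: (horner_map (in_alg L)).
have th0 : th != 0 by apply: contraNneq th1 => ->; apply: mem0v.
have on5 : zval (zmap (in_alg L) (zmap (horner_eval t) c)) g^-1 g = 0.
  rewrite cE; transitivity (in_alg L h.[t] * g ^+ 2 * (map_poly (in_alg L) n).[g^-1]).
    by rewrite nL /zval /=; field.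
  by rewrite ng mulr0.
have gVF : g^-1 \in F5 by rewrite rpredV.
have p5 := zpoint d on5 gVF gF (fun G _ zG => gg.2 G zG).
pose v := (b + in_alg L t) / (r b + in_alg L t).
have [bt rbt] : b + in_alg L t != 0 /\ r b + in_alg L t != 0.
  by move: h0; rewrite hE' pnE !mulf_eq0 !negb_or => /andP[/andP[]].
have on4 : zval (zmap (in_alg L) (zmap (horner_eval t) c)) th ((1 + sg * v) / th) = 0.
  have TL : T = b + r b := TE.
  rewrite cE; move: sgE; rewrite nL => nth.
  have -> : in_alg L p1.[t] = Y.[in_alg L t] - th * in_alg L p2.[t].
    by rewrite -YE' addrC addKr.
  rewrite YtE qE hE' pnE /zval /= /v TE.
  rewrite -!in_algE in nth bt rbt *.
  move: nth bt rbt; move: (in_alg L t) => t'; move: (in_alg L p2.[t]) => R2.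
  move: (in_alg L n`_1) (in_alg L n`_2) (in_alg L n`_3) (in_alg L n`_4) (in_alg L n`_5).
  move: ps.[t'] (r b) => P b' m1 m2 m3 m4 m5 nth bt rbt.
  transitivity ((b + t') * (b' + t') * P / th ^+ 2 * ((1 + m1 * th + m2 * th ^+ 2
    + m3 * th ^+ 3 + m4 * th ^+ 4 + m5 * th ^+ 5) - sg ^+ 2)).
    by field; rewrite rbt th0.
  by rewrite nth subrr mulr0.
have vF : v \in F4.
  have rbF : r b \in F4 by apply: memv_gal.
  by have := alg_mem F4 t; rewrite -in_algE /v => ?; solve_mem.
have v2 : v \notin F2.
  apply/negP => vF2; have := fixed_gal s24 rG vF2.
  have rK : r (in_alg L t) = in_alg L t by rewrite /= linearZ /= rmorph1.
  have [_ _ rr _] := rP b bF.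
  have -> : r v = (r b + in_alg L t) / (b + in_alg L t).
    rewrite /v fmorph_div !rmorphD.
    by congr ((_ + _) / (_ + _)).
  move/eqP; rewrite eqr_div // => /eqP e.
  have : (r b - b) * (T + 2 * in_alg L t) = 0.
    transitivity ((r b + in_alg L t) * (r b + in_alg L t)
      - (b + in_alg L t) * (b + in_alg L t)); first by rewrite TE; ring.
    by rewrite e subrr.
  move: Tt; rewrite hornerD hornerZ hornerC hornerX => Tt.
  by move/eqP; rewrite mulf_eq0 (negPf Tt) orbF subr_eq0 => /eqP/rb; apply/negP.
have thF4 : th \in F4 by apply: (subvP s24).
have z4 : (1 + sg * v) / th \in F4.
  have sgF4 : sg \in F4 by apply: (subvP s24).
  by solve_mem.
have g4 G : th \in G -> (1 + sg * v) / th \in G -> (F4 <= G)%VS.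
  move=> thG zG; have F2G : (F2 <= G)%VS.
    by apply: (generates_prime _ thF th1).2; rewrite ?d2.
  have sgG : sg \in G by apply: (subvP F2G).
  apply: (generates_step s24 d42 vF v2 F2G).
  have -> : v = ((1 + sg * v) / th * th - 1) / sg by field; rewrite sg0 th0.
  by solve_mem.
have p4 := zpoint d on4 thF4 z4 g4.
have [|||Q qf] := point_field_chord L_abelian _ _ _ p4 p5; rewrite ?d4 ?d5 //.
move: qf; rewrite prod_full ?d4 ?d5 ?dL //; exact: point_field_new.
Qed.

End Degree20.

(** * Degree 21 *)

Section NodalModel.
Variable R : comNzRingType.
Variables om sg d c1 c2 c3 c4 g6 g7 : R.

(* With w = om / d and s = sg / d, the plane cubic
     (w x + s y) Psi + (x + s) (x^2 - y) - (y - w) = 0,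
     Psi = c3 x^2 + c2 x + c1 + g6 x y + c4 y + g7 y^2,
   projected from its point (-s, w), where the tangent is l1 (x + s) + l0 (y - w) = 0. *)
Definition nodal_psi : R := c3 * sg ^+ 2 - c2 * sg * d + c1 * d ^+ 2 - g6 * sg * om
  + c4 * om * d + g7 * om ^+ 2.
Definition nodal_l0 : R := sg * nodal_psi - d ^+ 3.
Definition nodal_l1 : R := om * nodal_psi + sg ^+ 2 * d - om * d ^+ 2.

Definition nodal_model : zcubic R :=
  let l0 := nodal_l0 in let l1 := nodal_l1 in
  let a := - (2 * c3 * sg) + c2 * d + g6 * om in
  let b := - (g6 * sg) + c4 * d + 2 * g7 * om in
  let r2 := om * a - 2 * d * sg in let r1 := om * b + sg * a - d ^+ 2 in
  let r0 := sg * b in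
  let f3 := om * c3 + d in let f2 := om * g6 + sg * c3 in
  let f1 := om * g7 + sg * g6 in let f0 := sg * g7 in
  ZCubic l0 (d * (r2 * l0 ^+ 2 - r1 * l0 * l1 + r0 * l1 ^+ 2))
    (d * (r1 * l0 - 2 * r0 * l1)) (d * r0)
    (d ^+ 2 * (f3 * l0 ^+ 3 - f2 * l0 ^+ 2 * l1 + f1 * l0 * l1 ^+ 2 - f0 * l1 ^+ 3))
    (d ^+ 2 * (f2 * l0 ^+ 2 - 2 * f1 * l0 * l1 + 3 * f0 * l1 ^+ 2))
    (d ^+ 2 * (f1 * l0 - 3 * f0 * l1)) (d ^+ 2 * f0).

Definition nodal_cubic (x y : R) : R :=
  (om * x + sg * y) * (c3 * x ^+ 2 + c2 * x + c1 + g6 * x * y + c4 * y + g7 * y ^+ 2)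
  + (d * x + sg) * (x ^+ 2 - y) - (d * y - om).
End NodalModel.

Lemma nodal_model_map (R S : comNzRingType) (f : {rmorphism R -> S})
    om sg d c1 c2 c3 c4 g6 g7 :
  zmap f (nodal_model om sg d c1 c2 c3 c4 g6 g7)
  = nodal_model (f om) (f sg) (f d) (f c1) (f c2) (f c3) (f c4) (f g6) (f g7).
Proof.
by rewrite /zmap /nodal_model /nodal_l0 /nodal_l1 /nodal_psi /=; congr ZCubic; ring.
Qed.

Lemma nodal_model_on (F : fieldType) (om sg d c1 c2 c3 c4 g6 g7 x y : F) :
  let l0 := nodal_l0 om sg d c1 c2 c3 c4 g6 g7 in
  let l1 := nodal_l1 om sg d c1 c2 c3 c4 g6 g7 in
  let q := l1 * (x + sg / d) + l0 * (y - om / d) in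
  d != 0 -> q != 0 -> nodal_cubic om sg d c1 c2 c3 c4 g6 g7 x y = 0 ->
  zval (nodal_model om sg d c1 c2 c3 c4 g6 g7) ((x + sg / d) / q) (l0 / q) = 0.
Proof.
move=> l0 l1 q d0 q0 e; pose X := x + sg / d; pose Y := y - om / d.
pose a := - (2 * c3 * sg) + c2 * d + g6 * om.
pose b := - (g6 * sg) + c4 * d + 2 * g7 * om.
have bracket : q + d * ((om * X + sg * Y) * (a * X + b * Y) - d * X * (2 * sg * X + d * Y))
    + d ^+ 2 * ((om * X + sg * Y) * (c3 * X ^+ 2 + g6 * X * Y + g7 * Y ^+ 2) + d * X ^+ 3)
    = d ^+ 2 * nodal_cubic om sg d c1 c2 c3 c4 g6 g7 x y.
  by rewrite /q /l1 /l0 /nodal_l1 /nodal_l0 /nodal_psi /nodal_cubic /X /Y /a /b; field.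
rewrite e mulr0 in bracket.
rewrite -[RHS](mulr0 (l0 ^+ 3 / q ^+ 3)) -bracket.
have qE : q = l1 * X + l0 * Y by [].
rewrite /zval /nodal_model /= -/l0 -/l1 -/a -/b -/X; move: q0; rewrite qE.
clearbody X Y a b l0 l1 => q0.
by field.
Qed.

(** The fibre at 0 has a node at the origin, and modulo X^2 the discriminant is - b2^3 a6. A simple
    zero of a6 thus gives a simple zero of the discriminant. *)
Lemma disc_node_neq0 (F : fieldType) (w : weier {poly F}) (q : {poly F}) :
  (w3 w).[0] = 0 -> (w4 w).[0] = 0 -> w6 w = 'X * q -> q.[0] != 0 ->
  ((w1 w) ^+ 2 + 4 * w2 w).[0] != 0 -> disc w != 0.
Proof.
case: w => a1 a2 a3 a4 a6 /= h3 h4 -> q0 b20.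
have [u ->] : exists u, a3 = 'X * u.
  have /factor_theorem[u ->] : root a3 0 by apply/rootP.
  by exists u; rewrite subr0 mulrC.
have [v ->] : exists v, a4 = 'X * v.
  have /factor_theorem[v ->] : root a4 0 by apply/rootP.
  by exists v; rewrite subr0 mulrC.
pose b2 := a1 ^+ 2 + 4 * a2; pose b4 := 2 * v + a1 * u.
pose b6 := 'X * u ^+ 2 + 4 * q.
pose D := 'X * (- b2 ^+ 2 * (- a1 * u * v + a2 * u ^+ 2 - v ^+ 2)
   - 8 * 'X * b4 ^+ 3 - 27 * b6 ^+ 2 + 9 * b2 * b4 * b6) - b2 ^+ 3 * q.
have -> : disc (Weier a1 a2 ('X * u) ('X * v) ('X * q)) = 'X * D.
  by rewrite /disc /= /D /b6 /b4 /b2; ring.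
rewrite mulf_neq0 ?polyX_eq0 //; apply: contraNneq (mulf_neq0 (expf_neq0 3 b20) q0).
move=> /(congr1 (fun p : {poly F} => p.[0])).
by rewrite /D hornerD hornerM hornerX mul0r add0r hornerN hornerM horner_exp horner0
  => /eqP; rewrite oppr_eq0.
Qed.

Section PrimeConjugation.
Variables (K : fieldType) (L : splittingFieldType K).
Hypothesis L_abelian : abelian_extension L.
Implicit Types (F G U : {subfield L}).
Local Notation "''Gal' ( V / U )" := (galoisG V U) : ring_scope.

Lemma prime_conj F : prime (\dim F) -> exists2 s, s \in 'Gal(F / 1) &
  forall b, b \in F -> iter (\dim F) s b = b /\ (s b = b -> b \in 1%VS).
Proof.
move=> pF; have cG := card_gal1 L_abelian F.
have /trivgPn[s sG s1] : 'Gal(F / 1)%g != 1%g.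
  by rewrite trivg_card1 cG; apply: contraTneq pF => ->.
have os : #[s]%g = \dim F.
  have := order_dvdG sG; rewrite cG => /(primeP pF).2/orP[]/eqP // o1.
  by case/negP: s1; rewrite -order_eq1 o1.
have GE : 'Gal(F / 1)%g = <[s]>%g.
  by apply/esym/eqP; rewrite eqEcard cycle_subG sG cG /= -os.
have powE n b : b \in F -> (s ^+ n)%g b = iter n s b.
  elim: n => [|n IH] bF; first by rewrite expg0 gal_id.
  by rewrite expgSr galM // IH.
exists s => // b bF; split; first by rewrite -powE // -os expg_order gal_id.
move=> sb; rewrite -(galois_fixedField (galois_sub L_abelian F)).
apply/fixedFieldP => // x; rewrite GE => /cycleP[n ->]; rewrite powE //.
by elim: n => //= n ->.
Qed.

(** Every quotient s u / u has norm 1. If those of b and b + 1 were both in K, then s (b + 1) = s b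
    + 1 would force s b = b. *)
Lemma norm_one_ex F : prime (\dim F) -> exists y, [/\ y \in F, y \notin 1%VS
  & galNorm 1 F y = 1].
Proof.
move=> pF; have [s sG sP] := prime_conj pF.
have [b gb] := generates_ex L_abelian F; have bF := gb.1.
have b1 := generates_notin gb (prime_gt1 pF).
have N1 u : u \in F -> u != 0 -> galNorm 1 F (s u / u) = 1.
  move=> uF u0; rewrite galNormM galNormV galNorm_gal //.
  by rewrite mulfV // galNorm_eq0.
have uF u : u \in F -> s u / u \in F.
  by move=> h; rewrite rpredM ?rpredV ?memv_gal.
have b0 : b != 0 := generates_eq0 gb (prime_gt1 pF).
have b0' : b + 1 != 0.
  by apply: contraNneq b1 => /eqP; rewrite addr_eq0 => /eqP ->; rewrite rpredN mem1v.
have [/mem1P[k kE]|n] := boolP (s b / b \in 1%VS); last by exists (s b / b); split; auto.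
have b1F : b + 1 \in F by rewrite rpredD ?mem1v.
have [/mem1P[l lE]|n] := boolP (s (b + 1) / (b + 1) \in 1%VS); last first.
  by exists (s (b + 1) / (b + 1)); split; auto.
rewrite -!in_algE in kE lE.
have sb : s b = in_alg L k * b by rewrite -kE divfK.
have : s (b + 1) = in_alg L l * (b + 1) by rewrite -lE divfK.
rewrite rmorphD rmorph1 /= sb -!in_algE => e.
have := @quadratic_dependent K L k 1 l l b b1; rewrite -!in_algE.
case; first by rewrite rmorph1 e; ring.
move=> kl l1; case/negP: b1; apply: (sP b bF).2.
by rewrite sb kl -l1 rmorph1 mul1r.
Qed.

Lemma coef_prod_affine (I : Type) (r : seq I) (P D : I -> L) :
  (\prod_(i <- r) ((P i)%:P + D i *: 'X))`_(size r) = \prod_(i <- r) D i.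
Proof.
suff [_ ->] : (size (\prod_(i <- r) ((P i)%:P + D i *: 'X))%R <= (size r).+1)%N /\
  (\prod_(i <- r) ((P i)%:P + D i *: 'X))`_(size r) = \prod_(i <- r) D i by [].
elim: r => [|i r [sr IH]]; first by rewrite !big_nil size_poly1 coef1.
rewrite !big_cons /=; move: sr IH; set q := \prod_(i <- r) _ => sr IH; split.
  rewrite (leq_trans (size_polyMleq _ _)) // -subn1 leq_subLR.
  rewrite -[(size r).+2]/(1 + (size r).+1)%N addnA leq_add // (leq_trans (size_polyD _ _)) //.
  rewrite geq_max (leq_trans (size_polyC_leq1 _)) //.
  by rewrite (leq_trans (size_scale_leq _ _)) ?size_polyX.
rewrite mulrDl coefD coefCM nth_default // mulr0 add0r -scalerAl coefZ.
by rewrite coefXM /= IH.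
Qed.

Lemma norm_poly_top F (P D : L) : (norm_poly F P D)`_(\dim F) = galNorm 1 F D.
Proof.
rewrite /norm_poly /galNorm -!big_enum /= -(card_gal1 L_abelian) cardE.
exact: coef_prod_affine.
Qed.

(** The condition on g at -1 is the one linear relation among its coefficients that [septic_point]
    requires. For g = N(1 + X G) with G = 1 / (1 - y), it follows from 1 - G = - y G, N(y) = 1 and
    the odd degree. *)
Lemma septic_norm F : \dim F = 7%N -> exists (h : L) (g : {poly K}),
  [/\ generates F h, [/\ (size g <= 8)%N, g`_0 = 1 & g`_7 != 0],
    (map_poly (in_alg L) g).[h] = 0 & g.[-1] = - g`_7].
Proof.
move=> dF; have pF : prime (\dim F) by rewrite dF.
have [y [yF y1 Ny]] := norm_one_ex pF.
have yn : 1 - y != 0 by rewrite subr_eq0; apply: contraNneq y1 => <-; apply: mem1v.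
pose G := (1 - y)^-1; have GF : G \in F by rewrite rpredV rpredB ?mem1v.
have G0 : G != 0 by rewrite invr_eq0.
have [g gE] := norm_polyP L_abelian (mem1v F) GF.
have evE (x : K) : in_alg L g.[x] = galNorm 1 F (1 + x%:A * G).
  by rewrite -norm_poly_eval -gE -horner_map.
have g7 : in_alg L g`_7 = galNorm 1 F G by rewrite -(norm_poly_top F 1) dF -gE coef_map.
have hF : y - 1 \in F by rewrite rpredB ?mem1v.
exists (y - 1), g; split.
- apply: generates_prime => //; apply: contra y1 => h.
  by rewrite -[y](subrK 1) rpredD ?mem1v.
- split.
  + by rewrite -(size_map_poly (in_alg L)) gE (leq_trans (size_norm_poly L_abelian _ _ _)) ?dF.
  + apply: (fmorph_inj (in_alg L)); rewrite -horner_coef0; apply: etrans (evE 0) _.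
    by rewrite scale0r mul0r addr0 galNorm1 /= scale1r.
  + by rewrite -(fmorph_eq0 (in_alg L)) -[X in X == _]/(in_alg L g`_7) g7 galNorm_eq0.
- rewrite gE norm_poly_root // /G -[y - 1]opprB mulNr mulfV // subrr //.
apply: (fmorph_inj (in_alg L)); apply: etrans (evE (-1)) _; rewrite rmorphN.
transitivity (- in_alg L g`_7); last by [].
rewrite g7; have -> : 1 + (-1)%:A * G = (-1)%:A * y * G.
  by rewrite scaleN1r; apply: (mulIf yn); rewrite /G -!mulrA !mulVf // mulrDl mulN1r; field.
rewrite galNormM norm_scale // dF Ny.
by rewrite -signr_odd /= expr1 scaleN1r mulr1 mulN1r.
Qed.

(** These make A = A1 + A0 t have trace c1 t, as [cubic_point] requires. The second symmetric
    function of the conjugates of A1 must be nonzero for the discriminant of the family to have only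
    a simple zero at t = 0. *)
Lemma cubic_traces F (c1 : K) : \dim F = 3%N -> exists (s : gal_of F) (A1 A0 : L),
  [/\ A1 \in F, A0 \in F, forall b, b \in F -> s (s (s b)) = b /\ (s b = b -> b \in 1%VS)
  & [/\ A1 + s A1 + s (s A1) = 0, A1 * s A1 + A1 * s (s A1) + s A1 * s (s A1) != 0
     & A0 + s A0 + s (s A0) = in_alg L c1]].
Proof.
move=> dF; have pF : prime (\dim F) by rewrite dF.
have [s _ sP'] := prime_conj pF.
have sP b : b \in F -> s (s (s b)) = b /\ (s b = b -> b \in 1%VS).
  by move=> bF; have := sP' b bF; rewrite dF.
have [b gb] := generates_ex L_abelian F; have bF := gb.1.
have b1 := generates_notin gb (prime_gt1 pF).
have [sss sb] := sP b bF.
have sFF u : u \in F -> s u \in F by move=> uF; apply: memv_gal.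
have n01 : b - s b != 0 by rewrite subr_eq0; apply: contraNneq b1 => /esym/sb.
have n12 : s b - s (s b) != 0 by rewrite -rmorphB fmorph_eq0.
have n20 : s (s b) - b != 0.
  by rewrite -[X in _ - X]sss -!rmorphB !fmorph_eq0.
have [A0 A0F A0E] : exists2 A0, A0 \in F & A0 + s A0 + s (s A0) = in_alg L c1.
  have [u uF un] : exists2 u, u \in F & u + s u + s (s u) != 0.
    apply: contrapT => no.
    have tr0 u : u \in F -> u + s u + s (s u) = 0.
      by move=> uF; apply/eqP/negPn/negP => h; apply: no; exists u.
    have := tr0 1 (mem1v _); have := tr0 b bF; have := tr0 _ (rpredX 2 bF).
    rewrite !rmorphXn !rmorph1 => t2 t1 t0.
    (* Sum of (X - s b) (X - s (s b)) over the conjugates of b. *)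
    have /eqP[] := mulf_neq0 n01 n20.
    transitivity (- ((b ^+ 2 + s b ^+ 2 + s (s b) ^+ 2)
      - (s b + s (s b)) * (b + s b + s (s b)) + s b * s (s b) * (1 + 1 + 1))).
      by ring.
    by rewrite t2 t1 t0; ring.
  have [k kE] : exists k : K, u + s u + s (s u) = in_alg L k.
    apply/mem1P; have tF : u + s u + s (s u) \in F by rewrite !rpredD ?sFF.
    by apply: (sP _ tF).2; rewrite !rmorphD /= (sP u uF).1; ring.
  have kn : in_alg L k != 0 by rewrite -kE.
  exists (in_alg L (c1 / k) * u); first by rewrite rpredM // alg_mem.
  have sK (x : K) : s (in_alg L x) = in_alg L x by rewrite /= linearZ /= rmorph1.
  transitivity (in_alg L (c1 / k) * (u + s u + s (s u))).
    have sM (x y : L) : s (x * y) = s x * s y by rewrite rmorphM.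
    by rewrite !sM !sK; ring.
  by rewrite kE -rmorphM divfK // -(fmorph_eq0 (in_alg L)).
exists s; suff [A1 A1F [t1 e1]] : exists2 A1, A1 \in F & A1 + s A1 + s (s A1) = 0 /\
    A1 * s A1 + A1 * s (s A1) + s A1 * s (s A1) != 0.
  by exists A1, A0.
pose e2 (x y z : L) := x * y + x * z + y * z.
pose a := b - s b.
have aF : a \in F by rewrite rpredB ?sFF.
have saE : s a = s b - s (s b) by rewrite rmorphB.
have ssaE : s (s a) = s (s b) - b by rewrite saE rmorphB /= sss.
have tra : a + s a + s (s a) = 0 by rewrite ssaE saE /a; ring.
have [ea|na] := eqVneq (e2 a (s a) (s (s a))) 0; last by exists a.
(* If a = b - s b fails, then outside characteristic 3 the element a + a^2 has second symmetric
   function -3 N(a). In characteristic 3 the failure forces s a = a, the conjugates of b form an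
   arithmetic progression, and b^2 - (s b)^2 gives - a^4. *)
have [c3|c3] := eqVneq (3 : L) 0; last first.
  exists (a + a ^+ 2); first by rewrite rpredD ?rpredX.
  have sA x : s (x + x ^+ 2) = s x + s x ^+ 2 by rewrite rmorphD rmorphXn.
  rewrite !sA; move: tra ea; rewrite /e2.
  have : a * s a * s (s a) != 0 by rewrite ssaE saE !mulf_neq0.
  move: (s a) (s (s a)) => y z n tra ea; split.
    transitivity ((a + y + z) + (a + y + z) ^+ 2 - 2 * (a * y + a * z + y * z)); first by ring.
    by rewrite tra ea; ring.
  have -> : (a + a ^+ 2) * (y + y ^+ 2) + (a + a ^+ 2) * (z + z ^+ 2)
      + (y + y ^+ 2) * (z + z ^+ 2) = - (3 * (a * y * z))
    + (a * y + a * z + y * z) * (1 + (a + y + z) + (a * y + a * z + y * z))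
    - 2 * (a + y + z) * (a * y * z) by ring.
  by rewrite tra ea mul0r mulr0 mul0r subr0 addr0 oppr_eq0 mulf_neq0.
have sa : s b - s (s b) = a.
  rewrite -saE; apply/eqP; rewrite -subr_eq0 -sqrf_eq0; apply/eqP.
  move: tra ea; rewrite /e2; move: (s a) (s (s a)) => y z tra ea.
  have zE : z = - a - y by rewrite -[RHS](addr0) -tra; ring.
  transitivity (- (a * y + a * z + y * z) - 3 * (a * y)); first by rewrite zE; ring.
  by rewrite ea c3; ring.
exists (b ^+ 2 - s b ^+ 2); first by rewrite rpredB ?rpredX ?sFF.
have sA x y : s (x ^+ 2 - y ^+ 2) = s x ^+ 2 - s y ^+ 2 by rewrite rmorphB !rmorphXn.
rewrite !sA sss; split; first by ring.
have sbE : s b = b - a by rewrite /a; ring.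
have ssbE : s (s b) = b - 2 * a.
  by transitivity (s b - (s b - s (s b))); [ring | rewrite sa sbE; ring].
rewrite ssbE sbE.
have -> : (b ^+ 2 - (b - a) ^+ 2) * ((b - a) ^+ 2 - (b - 2 * a) ^+ 2) +
    (b ^+ 2 - (b - a) ^+ 2) * ((b - 2 * a) ^+ 2 - b ^+ 2) +
    ((b - a) ^+ 2 - (b - 2 * a) ^+ 2) * ((b - 2 * a) ^+ 2 - b ^+ 2)
  = - a ^+ 4 + 3 * (8 * a ^+ 3 * b - 4 * a ^+ 2 * b ^+ 2 - 4 * a ^+ 4) by ring.
by rewrite c3 mul0r addr0 oppr_eq0 expf_neq0.
Qed.

End PrimeConjugation.

Lemma nodal_model0 (R : comNzRingType) (d c1 c2 c3 c4 g6 g7 : R) :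
  nodal_model 0 0 d c1 c2 c3 c4 g6 g7
  = ZCubic (- d ^+ 3) 0 (d ^+ 6) 0 (- d ^+ 12) 0 0 0.
Proof. by rewrite /nodal_model /nodal_l0 /nodal_l1 /nodal_psi; congr ZCubic; ring. Qed.

Section Degree21.
Variables (K : fieldType) (L : splittingFieldType K).
Hypothesis L_abelian : abelian_extension L.
Hypothesis K_infinite : infinite_set [set: K]%classic.
Implicit Types (F G : {subfield L}).

Lemma nodal_point (om sg d c1 c2 c3 c4 g6 g7 : K)
    (dd : disc (zw (nodal_model om sg d c1 c2 c3 c4 g6 g7)) != 0) F (x y : L) :
  let f := in_alg L in
  let l0 := f (nodal_l0 om sg d c1 c2 c3 c4 g6 g7) in
  let l1 := f (nodal_l1 om sg d c1 c2 c3 c4 g6 g7) in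
  d != 0 -> generates F x -> y \in F ->
  l1 * (x + f sg / f d) + l0 * (y - f om / f d) != 0 ->
  nodal_cubic (f om) (f sg) (f d) (f c1) (f c2) (f c3) (f c4) (f g6) (f g7) x y = 0 ->
  exists P, point_field (zcurve dd) F P.
Proof.
move=> f l0 l1 d0 [xF gx] yF qn e.
have l0n : l0 != 0.
  rewrite fmorph_eq0; apply: contraNneq dd => l00.
  by rewrite disc_cofactorE /= l00; apply/eqP; ring.
have dL : f d != 0 by rewrite fmorph_eq0.
have fG k G : f k \in G by rewrite /f in_algE alg_mem.
pose q := l1 * (x + f sg / f d) + l0 * (y - f om / f d).
have l0E : nodal_l0 (f om) (f sg) (f d) (f c1) (f c2) (f c3) (f c4) (f g6) (f g7) = l0.
  by rewrite /l0 /nodal_l0 /nodal_psi; ring.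
have l1E : nodal_l1 (f om) (f sg) (f d) (f c1) (f c2) (f c3) (f c4) (f g6) (f g7) = l1.
  by rewrite /l1 /nodal_l1 /nodal_psi; ring.
have on : zval (zmap (in_alg L) (nodal_model om sg d c1 c2 c3 c4 g6 g7))
    ((x + f sg / f d) / q) (l0 / q) = 0.
  rewrite nodal_model_map -/f; have := nodal_model_on (x := x) (y := y) dL.
  by move=> /(_ (f om) (f sg) (f c1) (f c2) (f c3) (f c4) (f g6) (f g7)); rewrite l0E l1E; apply.
have qF : q \in F.
  have [h1 [h2 [h3 [h4 h5]]]] := (fG sg F, (fG d F, (fG om F, (fG _ F : l0 \in F, fG _ F : l1 \in F)))).
  by rewrite /q; solve_mem.
have XF : (x + f sg / f d) / q \in F.
  by have [h1 h2] := (fG sg F, fG d F); solve_mem.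
have zF : l0 / q \in F by have h0 : l0 \in F := fG _ F; solve_mem.
eexists; apply: (zpoint dd on XF zF) => G XG zG; apply: gx.
have -> : x = (x + f sg / f d) / q / (l0 / q) * l0 - f sg / f d.
  by have q0 : q != 0 := qn; field; rewrite l0n q0 dL.
by have [h1 [h2 h3]] := (fG sg G, (fG d G, fG _ G : l0 \in G)); solve_mem.
Qed.

Lemma tangent_neq0_line (l1 l0 sg om d : K) (x : L) : x \notin 1%VS -> l0 != 0 ->
  om != 0 -> d != 0 ->
  in_alg L l1 * (x + in_alg L sg / in_alg L d) + in_alg L l0 * (0 - in_alg L om / in_alg L d)
    != 0.
Proof.
move=> x1 l0n omn dn; rewrite sub0r; have [->|l1n] := eqVneq l1 0.
  by rewrite rmorph0 mul0r add0r mulrN oppr_eq0 !mulf_neq0 ?invr_eq0 ?fmorph_eq0.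
apply: contra x1 => /eqP e.
have l1L : in_alg L l1 != 0 by rewrite fmorph_eq0.
have dL : in_alg L d != 0 by rewrite fmorph_eq0.
have -> : x = in_alg L l0 * in_alg L om / in_alg L d / in_alg L l1 - in_alg L sg / in_alg L d.
  by apply: (mulfI l1L); rewrite -[LHS]subr0 -e; field; rewrite l1L dL.
have fG k : in_alg L k \in (1%AS : {subfield L}) by apply: alg_mem.
have [h1 [h2 [h3 [h4 h5]]]] := (fG l0, (fG l1, (fG sg, (fG om, fG d)))).
rewrite -[_ \in 1%VS]/(_ \in (1%AS : {subfield L})); solve_mem.
Qed.

Lemma tangent_neq0_cuspidal F (l1 l0 sg om d : K) (h : L) : generates F h ->
  (4 < \dim F)%N -> 1 + h != 0 -> l0 != 0 -> d != 0 ->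
  in_alg L l1 * (h + in_alg L sg / in_alg L d)
    + in_alg L l0 * (h ^+ 3 / (1 + h) - in_alg L om / in_alg L d) != 0.
Proof.
move=> gh d4 h1 l0n dn; apply/eqP => e.
(* Clearing denominators gives a monic cubic relation for h; multiplied by h it becomes a quartic
   without constant term, as [generates_quartic] expects. *)
pose k := l1 / l0; pose v := (l1 * sg - l0 * om) / (l0 * d).
have := generates_quartic k (k + v) v 0 gh d4; apply/negP; rewrite negbK.
have l0L : in_alg L l0 != 0 by rewrite fmorph_eq0.
have dL : in_alg L d != 0 by rewrite fmorph_eq0.
have kE : in_alg L k = in_alg L l1 / in_alg L l0 by rewrite fmorph_div.
have vE : in_alg L v = (in_alg L l1 * in_alg L sg - in_alg L l0 * in_alg L om)
    / (in_alg L l0 * in_alg L d).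
  by rewrite fmorph_div rmorphB !rmorphM.
have kvE : in_alg L (k + v) = in_alg L k + in_alg L v by rewrite rmorphD.
apply/eqP; rewrite kvE kE vE rmorph0 -[RHS](mulr0 (h * (1 + h) / in_alg L l0)) -[in RHS]e.
by field; rewrite h1 l0L dL.
Qed.

(* On y = 0 the curve cuts out a cubic in x, matched here with the norm of u + A x. *)
Lemma cubic_point (A B D u c1 c2 c3 c4 g6 g7 : L) : u != 0 -> A != 0 ->
  A + B + D = c1 * u ->
  nodal_cubic (u ^+ 3) (u * (A * B + A * D + B * D - c2 * u ^+ 2))
    (A * B * D - c3 * u ^+ 3) c1 c2 c3 c4 g6 g7 (- u / A) 0 = 0.
Proof.
move=> u0 A0 e; have -> : c1 = (A + B + D) / u by rewrite e mulfK.
by rewrite /nodal_cubic; field; rewrite u0 A0.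
Qed.

(* The constants are such that Psi = - 1 / x at this point of the nodal cubic
   x (x^2 - y) = y, which therefore lies on all the curves [nodal_cubic]. *)
Lemma septic_point (om sg d h g1 g2 g3 g4 g6 g7 : L) :
  let c1 := g1 - 2 in let c2 := g2 - 2 * g1 + 3 in
  let c3 := g3 - 2 * g2 + 3 * g1 - 4 in
  let c4 := g4 - 2 * g3 + 3 * g2 - 4 * g1 + 5 in
  h != 0 -> 1 + h != 0 ->
  1 + g1 * h + g2 * h ^+ 2 + g3 * h ^+ 3 + g4 * h ^+ 4 + (g6 + c3 + c4) * h ^+ 5
    + g6 * h ^+ 6 + g7 * h ^+ 7 = 0 ->
  nodal_cubic om sg d c1 c2 c3 c4 g6 g7 h (h ^+ 3 / (1 + h)) = 0.
Proof.
move=> c1 c2 c3 c4 h0 h1 e; pose y := h ^+ 3 / (1 + h).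
rewrite -[RHS](mulr0 ((om * h + sg * y) / (h * (1 + h) ^+ 2))) -e.
by rewrite /nodal_cubic /y /c1 /c2 /c3 /c4; field; rewrite h0 h1.
Qed.

Lemma case_3_7 F3 F7 : \dim F3 = 3%N -> \dim F7 = 7%N -> \dim {:L} = 21%N ->
  infinitely_many_new L.
Proof.
move=> d3 d7 dL.
have [h [g [gh [sg g0 g7] gh0 gm1]]] := septic_norm L_abelian d7.
pose c1 := g`_1 - 2; pose c2 := g`_2 - 2 * g`_1 + 3.
pose c3 := g`_3 - 2 * g`_2 + 3 * g`_1 - 4.
pose c4 := g`_4 - 2 * g`_3 + 3 * g`_2 - 4 * g`_1 + 5.
have g5 : g`_5 = g`_6 + c3 + c4.
  apply/eqP; rewrite -subr_eq0; apply/eqP; transitivity (- g`_7 - g.[-1]); last first.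
    by rewrite gm1; ring.
  rewrite (@horner_coef_wide _ 8) // !big_ord_recl big_ord0 /= g0 /c3 /c4; ring.
have [s [A1 [A0 [A1F A0F sP [t1 e1 t0]]]]] := cubic_traces L_abelian c1 d3.
have A1s : A1 - s A1 != 0.
  rewrite subr_eq0; apply: contraNneq e1 => e; apply/eqP; move: t1; rewrite -!e => t1.
  by transitivity (A1 * (A1 + A1 + A1)); [ring | rewrite t1 mulr0].
have A1n : A1 != 0.
  by apply: contraNneq A1s => ->; rewrite rmorph0 subr0.
(* These are the conjugates of A = A1 + A0 t as polynomials in t, so t^3, t S and d are the
   parameters prescribed by [cubic_point] with u = t. They are written over L but take values in K
   at t in K. *)
pose P0 := A1%:P + A0 *: 'X; pose P1 := (s A1)%:P + s A0 *: 'X.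
pose P2 := (s (s A1))%:P + s (s A0) *: 'X.
pose E2 := P0 * P1 + P0 * P2 + P1 * P2; pose E3 := P0 * P1 * P2.
pose S := E2 - (in_alg L c2)%:P * 'X^2; pose d := E3 - (in_alg L c3)%:P * 'X^3.
pose C (k : K) : {poly L} := (in_alg L k)%:P.
pose c := nodal_model 'X^3 ('X * S) d (C c1) (C c2) (C c3) (C c4) (C g`_6) (C g`_7).
have PE (u v x : L) : (u%:P + v *: 'X).[x] = u + v * x.
  by rewrite hornerD hornerC hornerZ hornerX.
have E2E x : E2.[x] = P0.[x] * P1.[x] + P0.[x] * P2.[x] + P1.[x] * P2.[x].
  by rewrite /E2 hornerD [in LHS]hornerD !hornerM.
have E3E x : E3.[x] = P0.[x] * P1.[x] * P2.[x] by rewrite /E3 !hornerM.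
have SE x : S.[x] = E2.[x] - in_alg L c2 * x ^+ 2.
  by rewrite /S; move: (E2) => p; rewrite hornerD hornerN hornerM hornerC hornerXn.
have dE x : d.[x] = E3.[x] - in_alg L c3 * x ^+ 3.
  by rewrite /d; move: (E3) => p; rewrite hornerD hornerN hornerM hornerC hornerXn.
have S0 : S.[0] != 0.
  by rewrite SE E2E !PE expr0n !mulr0 subr0 !addr0.
have dd0 : d.[0] != 0.
  rewrite dE E3E !PE expr0n !mulr0 subr0 !addr0 !mulf_neq0 ?fmorph_eq0 //.
have c0E : zmap (horner_eval 0) c = nodal_model 0 0 d.[0] (in_alg L c1) (in_alg L c2)
    (in_alg L c3) (in_alg L c4) (in_alg L g`_6) (in_alg L g`_7).
  have X0 : ('X^3 : {poly L}).[0] = 0 by rewrite hornerXn expr0n.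
  have XS0 : ('X * S).[0] = 0 by rewrite hornerM hornerX mul0r.
  rewrite nodal_model_map.
  by congr nodal_model; first [exact: X0 | exact: XS0 | exact: hornerC | done].
have wE : wmap (horner_eval 0) (zw c) = zw (ZCubic (- d.[0] ^+ 3) 0 (d.[0] ^+ 6) 0
    (- d.[0] ^+ 12) 0 0 0).
  by rewrite -zw_map c0E nodal_model0.
have disc0 : disc (zw c) != 0.
  pose r := ze c ^+ 2 * (zr2 c ^+ 2 * zf2 c + ze c * zf3 c ^+ 2 - zr1 c * zr2 c * zf3 c).
  (* a6 contains f0 = d^2 sg g7 with sg = t S, and S(0) is the second symmetric function of the
     conjugates of A1, so the zero at t = 0 is simple. *)
  apply: (@disc_node_neq0 _ _ (- (r * (d ^+ 2 * (S * C g`_7))))).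
  - by have /= := congr1 (@w3 _) wE; rewrite /horner_eval => ->; ring.
  - by have /= := congr1 (@w4 _) wE; rewrite /horner_eval => ->; ring.
  - rewrite /r /=; ring.
  - rewrite hornerN oppr_eq0 hornerM.
    have -> : r.[0] = - d.[0] ^+ 33.
      transitivity (ze (zmap (horner_eval 0) c) ^+ 2 * (zr2 (zmap (horner_eval 0) c) ^+ 2
        * zf2 (zmap (horner_eval 0) c) + ze (zmap (horner_eval 0) c)
        * zf3 (zmap (horner_eval 0) c) ^+ 2 - zr1 (zmap (horner_eval 0) c)
        * zr2 (zmap (horner_eval 0) c) * zf3 (zmap (horner_eval 0) c))).
        rewrite -[LHS]/(horner_eval 0 r) /r; move: (c) => c'; rewrite /=; ring.
      by rewrite c0E nodal_model0 /=; ring.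
    rewrite hornerM horner_exp hornerM hornerC !mulf_neq0 ?oppr_eq0 ?expf_neq0 //.
    by rewrite fmorph_eq0.
  - have -> : (w1 (zw c) ^+ 2 + 4 * w2 (zw c)).[0] = d.[0] ^+ 12.
      transitivity (w1 (wmap (horner_eval 0) (zw c)) ^+ 2
          + 4 * w2 (wmap (horner_eval 0) (zw c))).
        by rewrite -[LHS]/(horner_eval 0 _); move: (zw c) => w /=; ring.
      by rewrite wE /=; ring.
    by rewrite expf_neq0.
(* The last factor is A - s A as a polynomial in t: it keeps A outside K, so that - t / A generates
   F3. *)
apply: (@infinite_family K L L (in_alg L)
  [set t : K | ('X * d * ((A1 - s A1)%:P + (A0 - s A0) *: 'X)).[in_alg L t] != 0]%classic
  c 0) => //.
- apply: infinite_nonroots => //; rewrite !mulf_neq0 ?polyX_eq0 //.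
    by apply: contraNneq dd0 => ->; rewrite horner0.
  by apply: contraNneq A1s => e; have := PE (A1 - s A1) (A0 - s A0) 0; rewrite e horner0 mulr0 addr0 => <-.
- rewrite -[LHS]/(horner_eval 0 _) -zdisc_map c0E nodal_model0 disc_cofactorE /disc_cofactor /=; ring.
- rewrite -[_.[0]]/(horner_eval 0 _) -zinv4_map c0E nodal_model0.
  by rewrite (_ : inv4 _ = d.[0] ^+ 24) ?expf_neq0 // /inv4 /=; ring.
move=> t /= Tt; set u := in_alg L t in Tt *.
have [t0n dn An] : [/\ u != 0, d.[u] != 0 & A1 - s A1 + (A0 - s A0) * u != 0].
  by move: Tt; rewrite !hornerM hornerX PE !mulf_eq0 !negb_or => /andP[/andP[]].
have [A AE] : exists A, A = A1 + A0 * u by exists (A1 + A0 * u).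
have uF : u \in F3 by rewrite /u in_algE alg_mem.
have AF : A \in F3 by rewrite AE rpredD ?rpredM.
have su : s u = u by rewrite /u /= linearZ /= rmorph1.
have sM (x y : L) : s (x * y) = s x * s y by rewrite rmorphM.
have sD (x y : L) : s (x + y) = s x + s y by rewrite rmorphD.
have sA : s A = s A1 + s A0 * u by rewrite AE sD sM su.
have ssA : s (s A) = s (s A1) + s (s A0) * u by rewrite sA sD sM su.
have fixK y : y \in F3 -> s y = y -> exists k : K, y = in_alg L k.
  by move=> yF sy; apply/mem1P; apply: (sP y yF).2.
have sAF : s A \in F3 by apply: memv_gal.
have ssAF : s (s A) \in F3 by apply: memv_gal.
have [sssA Afix] := sP A AF.
have trA : A + s A + s (s A) = in_alg L c1 * u.
  transitivity ((A1 + s A1 + s (s A1)) + (A0 + s A0 + s (s A0)) * u).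
    by rewrite ssA sA AE; ring.
  by rewrite t1 t0 add0r.
have [k2 k2E] : exists k : K, A * s A + A * s (s A) + s A * s (s A) = in_alg L k.
  apply: fixK; first by rewrite !rpredD ?rpredM.
  by rewrite !sD !sM sssA; ring.
have [k3 k3E] : exists k : K, A * s A * s (s A) = in_alg L k.
  apply: fixK; first by rewrite !rpredM.
  by rewrite !sM sssA; ring.
pose om0 := t ^+ 3; pose sg0 := t * (k2 - c2 * t ^+ 2); pose d0 := k3 - c3 * t ^+ 3.
have duE : d.[u] = in_alg L d0.
  rewrite dE E3E !PE -ssA -sA -AE k3E /d0 /u; ring.
have SuE : S.[u] = in_alg L (k2 - c2 * t ^+ 2).
  rewrite SE E2E !PE -ssA -sA -AE k2E /u; ring.
exists (nodal_model om0 sg0 d0 c1 c2 c3 c4 g`_6 g`_7); split.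
  have e1' : horner_eval u 'X^3 = in_alg L om0 by rewrite /horner_eval hornerXn /om0 rmorphXn.
  have e2' : horner_eval u ('X * S) = in_alg L sg0.
    by rewrite /horner_eval hornerM hornerX SuE /sg0 rmorphM.
  rewrite !nodal_model_map; apply/esym.
  by congr nodal_model; first [exact: e1' | exact: e2' | exact: duE | exact: hornerC].
move=> dd.
have d0n : d0 != 0 by rewrite -(fmorph_eq0 (in_alg L)) -[X in X == 0]duE.
have l0n : nodal_l0 om0 sg0 d0 c1 c2 c3 c4 g`_6 g`_7 != 0.
  by apply: contraNneq dd => l00; rewrite disc_cofactorE /= l00; apply/eqP; ring.
have [P3 p3] : exists P, point_field (zcurve dd) F3 P.
  have A1' : A \notin 1%VS.
    apply/negP => /mem1P[k]; rewrite -in_algE => kE; case/negP: An.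
    suff <- : A - s A = A1 - s A1 + (A0 - s A0) * u.
      by rewrite kE /= linearZ /= rmorph1 subrr.
    by rewrite sA AE; ring.
  have An0 : A != 0 by apply: contraNneq A1' => ->; apply: mem0v.
  pose x := - u / A.
  have xF : x \in F3 by rewrite rpredM ?rpredN ?rpredV.
  have x1 : x \notin 1%VS.
    apply: contra A1' => /mem1P[k]; rewrite -in_algE => kE.
    have kn : in_alg L k != 0 by rewrite -kE mulf_neq0 ?oppr_eq0 ?invr_eq0.
    have -> : A = in_alg L (- t / k).
      have k0 : k != 0 by rewrite -(fmorph_eq0 (in_alg L)).
      by apply: (mulIf kn); rewrite -rmorphM divfK // -kE /x mulrC divfK // rmorphN.
    exact: (alg_mem 1%AS).
  have gx : generates F3 x by apply: generates_prime; rewrite ?d3.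
  have om0n : om0 != 0.
    by rewrite expf_neq0 // -(fmorph_eq0 (in_alg L)).
  apply: (nodal_point dd d0n gx (mem0v _)).
    exact: tangent_neq0_line.
  have := cubic_point (in_alg L c2) (in_alg L c3) (in_alg L c4) (in_alg L g`_6)
    (in_alg L g`_7) t0n An0 trA.
  rewrite k2E k3E -/x => e; rewrite -[RHS]e; congr nodal_cubic.
  - by rewrite rmorphXn.
  - rewrite /sg0 /u; ring.
  - rewrite /d0 /u; ring.
have [P7 p7] : exists P, point_field (zcurve dd) F7 P.
  have hF := gh.1; have h1 : h \notin 1%VS by apply: (generates_notin gh); rewrite d7.
  have h0 : h != 0 by apply: contraNneq h1 => ->; apply: mem0v.
  have h10 : 1 + h != 0.
    by apply: contraNneq h1 => /eqP; rewrite addrC addr_eq0 => /eqP ->; rewrite rpredN mem1v.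
  apply: (nodal_point dd (y := h ^+ 3 / (1 + h)) d0n gh).
  - by rewrite rpredM ?rpredX ?rpredV ?rpredD ?mem1v.
  - by apply: tangent_neq0_cuspidal gh _ _ _ _; rewrite // d7.
  have e : 1 + in_alg L g`_1 * h + in_alg L g`_2 * h ^+ 2 + in_alg L g`_3 * h ^+ 3
      + in_alg L g`_4 * h ^+ 4 + in_alg L (g`_6 + c3 + c4) * h ^+ 5
      + in_alg L g`_6 * h ^+ 6 + in_alg L g`_7 * h ^+ 7 = 0.
    rewrite -g5 -gh0 (@horner_coef_wide _ 8) ?size_map_poly //.
    rewrite !big_ord_recl big_ord0 !coef_map g0 /= -!in_algE; ring.
  rewrite -[RHS](@septic_point (in_alg L om0) (in_alg L sg0) (in_alg L d0) h
    (in_alg L g`_1) (in_alg L g`_2) (in_alg L g`_3) (in_alg L g`_4) (in_alg L g`_6)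
    (in_alg L g`_7) h0 h10).
    by congr nodal_cubic; rewrite /c1 /c2 /c3 /c4; ring.
  by rewrite -[RHS]e /c3 /c4; ring.
have [|||Q qf] := point_field_chord L_abelian _ _ _ p3 p7; rewrite ?d3 ?d7 //.
move: qf; rewrite prod_full ?d3 ?d7 ?dL //; exact: point_field_new.
Qed.

End Degree21.

(** * The theorem, by cases on the degree *)

Local Open Scope classical_set_scope.

Theorem proposition3p6 (K : fieldType) (L : splittingFieldType K)
    (K_infinite : infinite_set [set: K])
    (L_abelian : abelian_extension L)
    (degree_char_neq2 : 2%N \notin [pchar K] ->
       \dim {:L} \in [:: 12; 14; 15; 20; 21; 30]%N)
    (degree_char2 : 2%N \in [pchar K] ->
       \dim {:L} \in [:: 12; 14; 15; 20]%N) :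
  exists S : set (elliptic_curve K),
    [/\ infinite_set S,
        set_inj S (@j_invariant K) &
        forall E : elliptic_curve K, S E -> has_new_point L E].
Proof.
have sub p m : \dim {:L} = m -> exists F : {subfield L}, \dim F = (p ^ logn p m)%N.
  by move=> <-; rewrite -p_part; apply: subfield_partn.
have c12 (dL : \dim {:L} = 12%N) : infinitely_many_new L.
  have [[F3 d3] [F4 d4]] := (sub 3 _ dL, sub 2 _ dL).
  exact: (case_3_4 L_abelian K_infinite d3 d4 dL).
have c14 (dL : \dim {:L} = 14%N) : infinitely_many_new L.
  have [[F2 d2] [F7 d7]] := (sub 2 _ dL, sub 7 _ dL).
  exact: (case_2_7 L_abelian K_infinite d2 d7 dL).
have c15 (dL : \dim {:L} = 15%N) : infinitely_many_new L.
  have [[F3 d3] [F5 d5]] := (sub 3 _ dL, sub 5 _ dL).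
  exact: (case_3_5 L_abelian K_infinite d3 d5 dL).
have c20 (dL : \dim {:L} = 20%N) : infinitely_many_new L.
  have [[F4 d4] [F5 d5]] := (sub 2 _ dL, sub 5 _ dL).
  have [F2 [s24 d2]] := subfield_half L_abelian d4.
  exact: (case_4_5 L_abelian K_infinite s24 d2 d4 d5 dL).
have c21 (dL : \dim {:L} = 21%N) : infinitely_many_new L.
  have [[F3 d3] [F7 d7]] := (sub 3 _ dL, sub 7 _ dL).
  exact: (case_3_7 L_abelian K_infinite d3 d7 dL).
have [c2|c2] := boolP (2%N \in [pchar K]).
  by have := degree_char2 c2; rewrite !inE => /or4P[]/eqP; auto.
have c30 (dL : \dim {:L} = 30%N) : infinitely_many_new L.
  have [[F2 d2] [[F3 d3] [F5 d5]]] := (sub 2 _ dL, (sub 3 _ dL, sub 5 _ dL)).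
  exact: (case_2_3_5 L_abelian K_infinite c2 d2 d3 d5 dL).
by have := degree_char_neq2 c2; rewrite !inE => /orP[/eqP|/orP[/eqP|/orP[/eqP|/or3P[]/eqP]]]; auto.
Qed.
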